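(* For the lossy Gray–Wyner problem with side information described in the context, $\mathcal{R}^{\mathrm{inner}*}_{\mathrm{LGW}}\subseteq\mathcal{R}^{\mathrm{inner}}_{\mathrm{LGW}}\subseteq\mathcal{R}_{\mathrm{LGW}}$, and the region $\mathcal{R}^{\mathrm{inner}}_{\mathrm{LGW}}$ is convex.
   Context: Fix finite alphabets $\mathcal{X},\mathcal{Y}_1,\mathcal{Y}_2,\mathcal{V}_1,\mathcal{V}_2$, a joint law $P_{XY_1Y_2}$ on $\mathcal{X}\times\mathcal{Y}_1\times\mathcal{Y}_2$, and conditional laws $P_{V_1|X}$, $P_{V_2|X}$. Let $(X_t,Y_{1,t},Y_{2,t})_{t=1}^n$ be i.i.d. $\sim P_{XY_1Y_2}$. A sender observes $X^n$; receiver $i\in\{1,2\}$ observes $Y_i^n$. An encoder $\lambda^{(n)}:\mathcal{X}^n\to[2^{nR_0}]\times[2^{nR_1}]\times[2^{nR_2}]$ produces $(K_0,K_1,K_2)=\lambda^{(n)}(X^n)$ (with $[M]=\{1,\dots,\lfloor M\rfloor\}$); receiver $i$ gets $(K_0,K_i)$ noiselessly and outputs $\hat V_i^n=\Lambda_i^{(n)}(K_0,K_i,Y_i^n)\in\mathcal{V}_i^n$. Typicality: $x^n$ is $\epsilon$-typical w.r.t. $P_X$ if $|\pi_{x^n}(x)-P_X(x)|\le\epsilon P_X(x)$ for all $x$ ($\pi_{x^n}$ the empirical distribution); $\mathcal{T}^n_\epsilon(\cdot)$ denotes the (jointly) typical set. A triple $(R_0,R_1,R_2)$ is $\epsilon$-achievable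 if there are encoders/reconstruction functions with $\Pr((X^n,\hat V_i^n)\notin\mathcal{T}^n_\epsilon(P_{XV_i}))\to0$ as $n\to\infty$ for $i=1,2$, where $P_{XV_i}=P_X P_{V_i|X}$; it is achievable if $\epsilon$-achievable for all $\epsilon>0$. $\mathcal{R}_{\mathrm{LGW}}$ is the closure of the set of achievable triples. $\mathcal{R}^{\mathrm{inner}}_{\mathrm{LGW}}$ is the closure of the set of nonnegative $(R_0,R_1,R_2)$ such that, for some finite alphabet $\mathcal{V}_0$ and some conditional law $P_{V_0V_1V_2|X}$ whose $(V_1|X)$ and $(V_2|X)$ marginals equal $P_{V_1|X}$ and $P_{V_2|X}$, with $(V_0,V_1,V_2)-X-(Y_1,Y_2)$ a Markov chain: $R_1>I(X;V_1|V_0,Y_1)$, $R_2>I(X;V_2|V_0,Y_2)$, $R_0+R_1>I(X;V_0,V_1|Y_1)$, $R_0+R_2>I(X;V_0,V_2|Y_2)$. $\mathcal{R}^{\mathrm{inner}*}_{\mathrm{LGW}}$ is defined in the same way but with the constraints $R_0>\max_{i\in\{1,2\}}I(X;V_0|Y_i)$, $R_1>I(X;V_1|V_0,Y_1)$, $R_2>I(X;V_2|V_0,Y_2)$. *)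

(* Defs.v *)
From mathcomp Require Import all_boot.
From Stdlib Require Import Reals ZArith.

Set Implicit Arguments.
Unset Strict Implicit.
Unset Printing Implicit Defensive.

Local Open Scope R_scope.

Definition rsum (T : finType) (f : T -> R) : R := \big[Rplus/0]_(x : T) f x.

Definition is_pmf (T : finType) (p : T -> R) : Prop :=
  (forall t, 0 <= p t) /\ rsum p = 1.

Definition is_channel (A B : finType) (W : A -> B -> R) : Prop :=
  forall a, is_pmf (W a).

Definition log2 (x : R) : R := ln x / ln 2.

Definition entropy (A : finType) (p : A -> R) : R :=
  - rsum (fun a => if Rlt_dec 0 (p a) then p a * log2 (p a) else 0).

Definition pushfwd (O A : finType) (Q : O -> R) (f : O -> A) (a : A) : R :=
  rsum (fun w => if f w == a then Q w else 0).

Definition ent (O A : finType) (Q : O -> R) (f : O -> A) : R :=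
  entropy (pushfwd Q f).

Definition cmi (O A B C : finType) (Q : O -> R)
    (fA : O -> A) (fB : O -> B) (fC : O -> C) : R :=
  ent Q (fun w => (fA w, fC w)) + ent Q (fun w => (fB w, fC w))
  - ent Q (fun w => (fA w, fB w, fC w)) - ent Q fC.

Section Joint.
Variables (X Y1 Y2 V0 V1 V2 : finType).

Definition PX (P : X * Y1 * Y2 -> R) (x : X) : R :=
  rsum (fun y : Y1 * Y2 => P (x, y.1, y.2)).

(* joint law of (X, Y1, Y2, V0, V1, V2) = P_{XY1Y2} P_{V0V1V2|X}
   (this encodes the Markov chain (V0,V1,V2) - X - (Y1,Y2)) *)
Definition joint (P : X * Y1 * Y2 -> R) (W : X -> V0 * V1 * V2 -> R)
    (w : (X * Y1 * Y2) * (V0 * V1 * V2)) : R :=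
  P w.1 * W w.1.1.1 w.2.

Definition oX  (w : (X * Y1 * Y2) * (V0 * V1 * V2)) : X  := w.1.1.1.
Definition oY1 (w : (X * Y1 * Y2) * (V0 * V1 * V2)) : Y1 := w.1.1.2.
Definition oY2 (w : (X * Y1 * Y2) * (V0 * V1 * V2)) : Y2 := w.1.2.
Definition oV0 (w : (X * Y1 * Y2) * (V0 * V1 * V2)) : V0 := w.2.1.1.
Definition oV1 (w : (X * Y1 * Y2) * (V0 * V1 * V2)) : V1 := w.2.1.2.
Definition oV2 (w : (X * Y1 * Y2) * (V0 * V1 * V2)) : V2 := w.2.2.

Definition marginals_ok (W : X -> V0 * V1 * V2 -> R)
    (W1 : X -> V1 -> R) (W2 : X -> V2 -> R) : Prop :=
  (forall x v1, rsum (fun u : V0 * V2 => W x (u.1, v1, u.2)) = W1 x v1) /\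
  (forall x v2, rsum (fun u : V0 * V1 => W x (u.1, u.2, v2)) = W2 x v2).
End Joint.
Arguments oX {X Y1 Y2 V0 V1 V2} w.
Arguments oY1 {X Y1 Y2 V0 V1 V2} w.
Arguments oY2 {X Y1 Y2 V0 V1 V2} w.
Arguments oV0 {X Y1 Y2 V0 V1 V2} w.
Arguments oV1 {X Y1 Y2 V0 V1 V2} w.
Arguments oV2 {X Y1 Y2 V0 V1 V2} w.

Definition closure3 (S : R * R * R -> Prop) (r : R * R * R) : Prop :=
  forall d, 0 < d -> exists r', S r' /\
    Rabs (r.1.1 - r'.1.1) < d /\ Rabs (r.1.2 - r'.1.2) < d /\ Rabs (r.2 - r'.2) < d.

Definition convex3 (S : R * R * R -> Prop) : Prop :=
  forall r r' (l : R), S r -> S r' -> 0 <= l <= 1 ->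
    S (l * r.1.1 + (1 - l) * r'.1.1,
       l * r.1.2 + (1 - l) * r'.1.2,
       l * r.2 + (1 - l) * r'.2).

Definition inner_pre (X Y1 Y2 V1 V2 : finType) (P : X * Y1 * Y2 -> R)
    (W1 : X -> V1 -> R) (W2 : X -> V2 -> R) (r : R * R * R) : Prop :=
  0 <= r.1.1 /\ 0 <= r.1.2 /\ 0 <= r.2 /\
  exists (V0 : finType) (W : X -> V0 * V1 * V2 -> R),
    is_channel W /\ marginals_ok W W1 W2 /\
    let Q := joint P W in
    r.1.2 > cmi Q oX oV1 (fun w => (oV0 w, oY1 w)) /\
    r.2   > cmi Q oX oV2 (fun w => (oV0 w, oY2 w)) /\
    r.1.1 + r.1.2 > cmi Q oX (fun w => (oV0 w, oV1 w)) oY1 /\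
    r.1.1 + r.2   > cmi Q oX (fun w => (oV0 w, oV2 w)) oY2.

Definition R_inner (X Y1 Y2 V1 V2 : finType) (P : X * Y1 * Y2 -> R)
    (W1 : X -> V1 -> R) (W2 : X -> V2 -> R) : R * R * R -> Prop :=
  closure3 (inner_pre P W1 W2).

Definition inner_star_pre (X Y1 Y2 V1 V2 : finType) (P : X * Y1 * Y2 -> R)
    (W1 : X -> V1 -> R) (W2 : X -> V2 -> R) (r : R * R * R) : Prop :=
  0 <= r.1.1 /\ 0 <= r.1.2 /\ 0 <= r.2 /\
  exists (V0 : finType) (W : X -> V0 * V1 * V2 -> R),
    is_channel W /\ marginals_ok W W1 W2 /\
    let Q := joint P W in
    r.1.1 > Rmax (cmi Q oX oV0 oY1) (cmi Q oX oV0 oY2) /\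
    r.1.2 > cmi Q oX oV1 (fun w => (oV0 w, oY1 w)) /\
    r.2   > cmi Q oX oV2 (fun w => (oV0 w, oY2 w)).

Definition R_inner_star (X Y1 Y2 V1 V2 : finType) (P : X * Y1 * Y2 -> R)
    (W1 : X -> V1 -> R) (W2 : X -> V2 -> R) : R * R * R -> Prop :=
  closure3 (inner_star_pre P W1 W2).

Definition msize (n : nat) (rate : R) : nat :=
  Z.to_nat (Int_part (Rpower 2 (INR n * rate))).

Definition Rleb (a b : R) : bool := if Rle_dec a b then true else false.

Definition typicalb (A : finType) (p : A -> R) (eps : R) (s : seq A) : bool :=
  [forall a : A, Rleb (Rabs (INR (count_mem a s) / INR (size s) - p a)) (eps * p a)].

Definition iid (X Y1 Y2 : finType) (P : X * Y1 * Y2 -> R) (n : nat)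
    (t : n.-tuple X * n.-tuple Y1 * n.-tuple Y2) : R :=
  \big[Rmult/1]_(i < n) P (tnth t.1.1 i, tnth t.1.2 i, tnth t.2 i).

Definition err_prob (X Y1 Y2 A : finType) (P : X * Y1 * Y2 -> R) (n : nat)
    (p : A -> R) (eps : R)
    (f : n.-tuple X -> n.-tuple Y1 -> n.-tuple Y2 -> seq A) : R :=
  rsum (fun t : n.-tuple X * n.-tuple Y1 * n.-tuple Y2 =>
          iid P t * (if typicalb p eps (f t.1.1 t.1.2 t.2) then 0 else 1)).

Definition PXV (X Y1 Y2 V : finType) (P : X * Y1 * Y2 -> R) (W : X -> V -> R)
    (a : X * V) : R := PX P a.1 * W a.1 a.2.

Definition eps_achievable (X Y1 Y2 V1 V2 : finType) (P : X * Y1 * Y2 -> R)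
    (W1 : X -> V1 -> R) (W2 : X -> V2 -> R) (eps : R) (r : R * R * R) : Prop :=
  exists (enc : forall n : nat, n.-tuple X ->
                  'I_(msize n r.1.1) * 'I_(msize n r.1.2) * 'I_(msize n r.2))
         (dec1 : forall n : nat, 'I_(msize n r.1.1) -> 'I_(msize n r.1.2) ->
                  n.-tuple Y1 -> n.-tuple V1)
         (dec2 : forall n : nat, 'I_(msize n r.1.1) -> 'I_(msize n r.2) ->
                  n.-tuple Y2 -> n.-tuple V2),
    Un_cv (fun n => err_prob P (PXV P W1) eps
             (fun xs y1 _ => zip xs (dec1 n (enc n xs).1.1 (enc n xs).1.2 y1))) 0 /\
    Un_cv (fun n => err_prob P (PXV P W2) eps
             (fun xs _ y2 => zip xs (dec2 n (enc n xs).1.1 (enc n xs).2 y2))) 0.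

Definition achievable (X Y1 Y2 V1 V2 : finType) (P : X * Y1 * Y2 -> R)
    (W1 : X -> V1 -> R) (W2 : X -> V2 -> R) (r : R * R * R) : Prop :=
  forall eps, 0 < eps -> eps_achievable P W1 W2 eps r.

Definition R_LGW (X Y1 Y2 V1 V2 : finType) (P : X * Y1 * Y2 -> R)
    (W1 : X -> V1 -> R) (W2 : X -> V2 -> R) : R * R * R -> Prop :=
  closure3 (achievable P W1 W2).

(* Main.v *)
Require Import Defs.
From Stdlib Require Import Reals Lra ZArith Lia ClassicalEpsilon.
From HB Require Import structures.
From mathcomp Require Import all_boot.

(** Superposition coding with random binning, in a one-shot form.  Draw a random
codebook [C0] of words [v0], keeping each word with probability about
[2^(-n H(V0|X))], and over each [v0] codebooks [Ci(v0)] of words [vi], kept with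
probability about [2^(-n H(Vi|V0,X))]; independently give every [v0] and every
pair [(v0, vi)] a uniform random label of rate [R0] and [Ri].  The sender looks for
codewords of small expected error and transmits their labels; receiver [i] looks
for a codeword pair with the received labels that is likely given its side
information.  By Chebyshev's inequality a codebook usually has at least half its
expected mass under the law of the word given [X]; the cost of its best word is then
controlled by the mean cost under the i.i.d. joint law.  There a wrong pair with
the correct [v0] is accepted with probability about [2^(n (I(X;Vi|V0,Yi) - Ri))], one
with a wrong [v0] with probability about [2^(n (I(X;V0,Vi|Yi) - R0 - Ri))].  Only the
weak law of large numbers is used as [n] grows.  As [V1] and [V2] are selected
separately given [V0], the joint law of [(V1, V2)] plays no role.

The first inclusion is the chain rule for [I(X;V0,Vi|Yi)].  For convexity, two
auxiliary variables are combined into one with values in the disjoint union of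
their alphabets, so that it reveals the time-sharing variable. *)

Set Implicit Arguments.
Unset Strict Implicit.
Unset Printing Implicit Defensive.

Local Open Scope R_scope.

(** A word chosen by the sender is not distributed like an i.i.d. draw given the source, so its
    relation to the side information cannot be read off the joint law; usually a Markov lemma
    bridges this gap. Here the choice minimises a cost already averaged over the side information.
    If words are kept with probability [p] and the codebook [C] has [q]-mass at least [p / 2], some
    word of [C] costs at most [2 / p] times the sum of [q v * g v] over [C]. Averaging over the
    codebook replaces membership by [p], which cancels the division: the chosen word pays at most
    twice the i.i.d. cost. Clashes depend on the same codebook, but involve only two words of each
    code at a time, so pairwise independence is enough. The variance in Chebyshev's inequality is
    governed by the heaviest word. Hence words above a threshold [tau], slightly larger than the
    typical mass, are cut off in the estimate, and [p] exceeds the typical mass by a factor of about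
    [2^(2 n d)]. This excess and the width [d] of the decoding test are the whole loss in rate. *)

HB.instance Definition _ := Monoid.isComLaw.Build R 0 Rplus
  (fun a b c => esym (Rplus_assoc a b c)) Rplus_comm Rplus_0_l.
HB.instance Definition _ := Monoid.isComLaw.Build R 1 Rmult
  (fun a b c => esym (Rmult_assoc a b c)) Rmult_comm Rmult_1_l.
HB.instance Definition _ := Monoid.isMulLaw.Build R 0 Rmult Rmult_0_l Rmult_0_r.
HB.instance Definition _ := Monoid.isAddLaw.Build R Rmult Rplus
  Rmult_plus_distr_r Rmult_plus_distr_l.

Local Notation "\rsum_ x F" := (rsum (fun x => F))
  (at level 41, x name, F at level 41, right associativity).
Local Notation "\rsum_ ( x : T ) F" := (rsum (fun x : T => F))
  (at level 41, x name, F at level 41, right associativity).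
Local Notation "\rprod_ ( i < n ) F" := (\big[Rmult/1]_(i < n) F)
  (at level 36, i name, n at level 50, F at level 36).

Definition bR (b : bool) : R := if b then 1 else 0.

Lemma bR_ge0 b : 0 <= bR b. Proof. by case: b => /=; lra. Qed.
Lemma bR_le1 b : bR b <= 1. Proof. by case: b => /=; lra. Qed.
Lemma bRM b c : bR (b && c) = bR b * bR c. Proof. by case: b; case: c => /=; lra. Qed.

(** * Finite real sums *)

Section FiniteSums.
Variables A B : finType.
Implicit Types (f g : A -> R).

Lemma eq_rsum f g : (forall a, f a = g a) -> rsum f = rsum g.
Proof. by move=> e; apply: eq_bigr. Qed.

Lemma rsum_le f g : (forall a, f a <= g a) -> rsum f <= rsum g.
Proof.
move=> h; rewrite /rsum; elim/big_ind2: _ => // [|x y u v hx hu]; first exact: Rle_refl.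
exact: Rplus_le_compat.
Qed.

Lemma rsum0 : \rsum_(a : A) 0 = 0.
Proof. exact: big1. Qed.

Lemma rsum_ge0 f : (forall a, 0 <= f a) -> 0 <= rsum f.
Proof. by move=> h; rewrite -{1}rsum0; apply: rsum_le. Qed.

Lemma rsumD f g : \rsum_a (f a + g a) = rsum f + rsum g.
Proof. exact: big_split. Qed.

Lemma rsumMl c f : c * rsum f = \rsum_a c * f a.
Proof. exact: big_distrr. Qed.

Lemma rsumMr c f : rsum f * c = \rsum_a f a * c.
Proof. exact: big_distrl. Qed.

Lemma rsumB f g : \rsum_a (f a - g a) = rsum f - rsum g.
Proof.
have -> : rsum f - rsum g = rsum f + (-1) * rsum g by lra.
by rewrite rsumMl -rsumD; apply: eq_rsum => a; lra.
Qed.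

Lemma rsum_exchange (f : A -> B -> R) : (\rsum_a \rsum_b f a b) = \rsum_b \rsum_a f a b.
Proof. exact: exchange_big. Qed.

Lemma rsum_pair (f : A * B -> R) : rsum f = \rsum_a \rsum_b f (a, b).
Proof. by rewrite /rsum pair_bigA; apply: eq_bigr => -[]. Qed.

Lemma rsumD1 f a : rsum f = f a + \rsum_b bR (b != a) * f b.
Proof.
rewrite /rsum (bigD1 a) //=; congr (_ + _); rewrite big_mkcond /=.
by apply: eq_bigr => b _; case: (b != a) => /=; lra.
Qed.

Lemma rsum_eq1 f a : (\rsum_b bR (b == a) * f b) = f a.
Proof.
rewrite (rsumD1 _ a) eqxx /= (@eq_rsum _ (fun=> 0)) ?rsum0; first by lra.
by move=> b; case: (b == a) => /=; lra.
Qed.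

Lemma rsum_ge_term f a : (forall b, 0 <= f b) -> f a <= rsum f.
Proof.
move=> h; rewrite (rsumD1 _ a).
suff : 0 <= \rsum_b bR (b != a) * f b by lra.
by apply: rsum_ge0 => b; apply: Rmult_le_pos => //; apply: bR_ge0.
Qed.

Lemma rsum_reindex (h : B -> A) f : bijective h -> rsum f = \rsum_b f (h b).
Proof. by move=> bh; rewrite /rsum (reindex h) //; apply: onW_bij. Qed.

Lemma rsum_const (c : R) : \rsum_(a : A) c = INR #|A| * c.
Proof.
rewrite /rsum big_const; elim: #|A| => [|n ih]; first by rewrite /=; lra.
by rewrite S_INR /= ih; lra.
Qed.

End FiniteSums.

Lemma rsum_sum (A B : finType) (f : A + B -> R) :
  rsum f = (\rsum_a f (inl a)) + \rsum_b f (inr b).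
Proof. by rewrite /rsum big_sumType. Qed.

(** If [g] exceeded [M] wherever [w] is positive, the weighted sum would be too large. The
    conclusion [0 < w a] matters: later it certifies that the chosen word lies in the codebook. *)
Lemma exists_le_weighted_mean (A : finType) (w g : A -> R) (M : R) :
  (forall a, 0 <= w a) -> 0 < rsum w -> (\rsum_a w a * g a) <= M * rsum w ->
  exists a, 0 < w a /\ g a <= M.
Proof.
move=> w0 ws hM; apply: NNPP => nex.
have hg a : 0 < w a -> M < g a.
  by move=> wa; apply: Rnot_le_lt => ga; apply: nex; exists a.
have t0 a : 0 <= w a * (g a - M).
  case: (Rle_lt_or_eq_dec _ _ (w0 a)) => [wa|<-]; last by lra.
  by apply: Rmult_le_pos; [lra | have := hg a wa; lra].
have s0 : (\rsum_a w a * (g a - M)) <= 0.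
  rewrite (@eq_rsum _ _ (fun a => w a * g a - M * w a)); last by move=> a /=; lra.
  by rewrite rsumB -rsumMl; lra.
suff : rsum w = 0 by lra.
rewrite -(rsum0 A); apply: eq_rsum => a.
case: (Rle_lt_or_eq_dec _ _ (w0 a)) => [wa|<-] //.
have := rsum_ge_term a t0; have := hg a wa => h1 h2.
suff : 0 < w a * (g a - M) by lra.
by apply: Rmult_lt_0_compat; lra.
Qed.

(** * Entropy and the chain rule *)

Section Entropy.
Variables (O A : finType) (Q : O -> R).

Lemma pushfwdE (f : O -> A) a : pushfwd Q f a = \rsum_w bR (f w == a) * Q w.
Proof. by apply: eq_rsum => w; case: eqP => _ /=; lra. Qed.

Lemma rsum_pushfwd (f : O -> A) (g : A -> R) :
  (\rsum_a pushfwd Q f a * g a) = \rsum_w Q w * g (f w).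
Proof.
rewrite (@eq_rsum _ _ (fun a => \rsum_w bR (a == f w) * (Q w * g a))); last first.
  move=> a; rewrite pushfwdE rsumMr; apply: eq_rsum => w.
  by rewrite (eq_sym a); lra.
rewrite rsum_exchange; apply: eq_rsum => w.
by rewrite (rsum_eq1 (fun a => Q w * g a)).
Qed.

Hypothesis Q_ge0 : forall w, 0 <= Q w.

Lemma pushfwd_ge0 (f : O -> A) a : 0 <= pushfwd Q f a.
Proof.
by rewrite pushfwdE; apply: rsum_ge0 => w; apply: Rmult_le_pos => //; apply: bR_ge0.
Qed.

Lemma pushfwd_gt0 (f : O -> A) w : 0 < Q w -> 0 < pushfwd Q f (f w).
Proof.
move=> Qw; apply: (Rlt_le_trans _ (bR (f w == f w) * Q w)); first by rewrite eqxx /=; lra.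
rewrite pushfwdE; apply: (@rsum_ge_term _ (fun w' => bR (f w' == f w) * Q w')) => w'.
by apply: Rmult_le_pos => //; apply: bR_ge0.
Qed.

Lemma ent_mean_log (f : O -> A) : ent Q f = - \rsum_w Q w * log2 (pushfwd Q f (f w)).
Proof.
rewrite -(rsum_pushfwd f (fun a => log2 (pushfwd Q f a))) /ent /entropy; congr (- _).
apply: eq_rsum => a; case: Rlt_dec => //= np.
have -> : pushfwd Q f a = 0 by have := pushfwd_ge0 f a; lra.
by lra.
Qed.

End Entropy.

Lemma eq_pushfwd_fibre (O A B : finType) (Q : O -> R) (f : O -> A) (g : O -> B) w :
  (forall w', (f w' == f w) = (g w' == g w)) ->
  pushfwd Q f (f w) = pushfwd Q g (g w).
Proof. by move=> h; rewrite !pushfwdE; apply: eq_rsum => w'; rewrite h. Qed.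

(** Entropy depends only on the partition into fibres, so tuples nested or ordered differently can
    be exchanged inside [cmi]. *)
Lemma eq_ent_fibre (O A B : finType) (Q : O -> R) (f : O -> A) (g : O -> B) :
  (forall w, 0 <= Q w) -> (forall w' w, (f w' == f w) = (g w' == g w)) ->
  ent Q f = ent Q g.
Proof.
move=> Q0 h; rewrite !ent_mean_log //; congr (- _); apply: eq_rsum => w.
by rewrite (eq_pushfwd_fibre Q (fun w' => h w' w)).
Qed.

Lemma cmi_chain (O A B C D : finType) (Q : O -> R)
    (x : O -> A) (v0 : O -> B) (v : O -> C) (y : O -> D) :
  (forall w, 0 <= Q w) ->
  cmi Q x v0 y + cmi Q x v (fun w => (v0 w, y w)) = cmi Q x (fun w => (v0 w, v w)) y.
Proof.
move=> Q0; rewrite /cmi /=.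
rewrite (@eq_ent_fibre _ _ _ Q (fun w => (x w, v0 w, y w)) (fun w => (x w, (v0 w, y w)))) //;
  last by move=> w' w; rewrite !xpair_eqE andbA.
rewrite (@eq_ent_fibre _ _ _ Q (fun w => (v w, (v0 w, y w))) (fun w => (v0 w, v w, y w))) //;
  last by move=> w' w; rewrite !xpair_eqE andbCA andbA.
rewrite (@eq_ent_fibre _ _ _ Q (fun w => (x w, v w, (v0 w, y w)))
  (fun w => (x w, (v0 w, v w), y w))) //;
  last by move=> w' w; rewrite !xpair_eqE; do !case: (_ == _).
by lra.
Qed.

Lemma closure3_sub (S T : R * R * R -> Prop) :
  (forall r, S r -> T r) -> forall r, closure3 S r -> closure3 T r.
Proof. by move=> ST r h d d0; have [r' [Sr' hr']] := h d d0; exists r'; split; auto. Qed.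

Section JointLaw.
Variables (X Y1 Y2 V0 V1 V2 : finType).
Variables (P : X * Y1 * Y2 -> R) (W : X -> V0 * V1 * V2 -> R).
Hypotheses (P_pmf : is_pmf P) (W_chan : is_channel W).

Lemma joint_ge0 w : 0 <= joint P W w.
Proof. by apply: Rmult_le_pos; [apply: P_pmf.1 | apply: (W_chan _).1]. Qed.

Lemma rsum_joint (g : X * Y1 * Y2 -> R) :
  (\rsum_w joint P W w * g w.1) = \rsum_z P z * g z.
Proof.
rewrite rsum_pair; apply: eq_rsum => z; rewrite /joint /=.
rewrite (@eq_rsum _ _ (fun v => P z * g z * W z.1.1 v)); last by move=> v /=; lra.
by rewrite -rsumMl (W_chan z.1.1).2 Rmult_1_r.
Qed.

Lemma joint_pmf : is_pmf (joint P W).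
Proof.
split; first exact: joint_ge0.
rewrite (@eq_rsum _ _ (fun w => joint P W w * 1)); last by move=> w /=; lra.
rewrite (rsum_joint (fun=> 1)) -[RHS]P_pmf.2; by apply: eq_rsum => z; lra.
Qed.

Lemma ent_joint (A : finType) (f : X * Y1 * Y2 -> A) :
  ent (joint P W) (fun w => f w.1) = ent P f.
Proof.
rewrite !ent_mean_log; [|exact: P_pmf.1|exact: joint_ge0].
have e a : pushfwd (joint P W) (fun w => f w.1) a = pushfwd P f a.
  rewrite !pushfwdE.
  rewrite (@eq_rsum _ _ (fun w => joint P W w * bR (f w.1 == a)));
    last by move=> w; rewrite Rmult_comm.
  by rewrite (rsum_joint (fun z => bR (f z == a))); apply: eq_rsum => z; rewrite Rmult_comm.
congr (- _); rewrite -(rsum_joint (fun z => log2 (pushfwd P f (f z)))).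
by apply: eq_rsum => w; rewrite e.
Qed.

End JointLaw.

Lemma R_inner_star_sub (X Y1 Y2 V1 V2 : finType) (P : X * Y1 * Y2 -> R)
    (W1 : X -> V1 -> R) (W2 : X -> V2 -> R) :
  is_pmf P -> forall r, R_inner_star P W1 W2 r -> R_inner P W1 W2 r.
Proof.
move=> P_pmf; apply: closure3_sub => r [r0 [r1 [r2 [V0 [W [Wc [Wm [h0 [h1 h2]]]]]]]]].
do 3![split => //]; exists V0, W; do 4![split => //].
have Q0 := joint_ge0 P_pmf Wc.
rewrite -!(cmi_chain _ _ _ _ Q0).
have m1 := Rmax_l (cmi (joint P W) oX oV0 oY1) (cmi (joint P W) oX oV0 oY2).
have m2 := Rmax_r (cmi (joint P W) oX oV0 oY1) (cmi (joint P W) oX oV0 oY2).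
by split; lra.
Qed.

Lemma log2M a b : 0 < a -> 0 < b -> log2 (a * b) = log2 a + log2 b.
Proof. by move=> a0 b0; rewrite /log2 ln_mult //; lra. Qed.

(** * Convexity by time sharing *)

Section Mixture.
Variables (Oa Ob O : finType) (ia : Oa -> O) (ib : Ob -> O).
Hypothesis rsum_split : forall F : O -> R, rsum F = (\rsum_a F (ia a)) + \rsum_b F (ib b).
Variables (Qa : Oa -> R) (Qb : Ob -> R) (Q : O -> R) (l : R).
Hypotheses (Qa_pmf : is_pmf Qa) (Qb_pmf : is_pmf Qb) (l01 : 0 < l < 1).
Hypotheses (Q_ia : forall a, Q (ia a) = l * Qa a) (Q_ib : forall b, Q (ib b) = (1 - l) * Qb b).

(* [f] reveals which component was drawn, so the entropy of that choice adds up. *)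
Lemma ent_mixture (A B C : finType) (fa : Oa -> A) (fb : Ob -> B) (f : O -> C) :
  (forall w, 0 <= Q w) ->
  (forall a' a, (f (ia a') == f (ia a)) = (fa a' == fa a)) ->
  (forall b' b, (f (ib b') == f (ib b)) = (fb b' == fb b)) ->
  (forall a b, (f (ia a) == f (ib b)) = false) ->
  ent Q f = l * ent Qa fa + (1 - l) * ent Qb fb - l * log2 l - (1 - l) * log2 (1 - l).
Proof.
move=> Q0 ea eb eab.
have pa a : pushfwd Q f (f (ia a)) = l * pushfwd Qa fa (fa a).
  rewrite !pushfwdE rsum_split rsumMl -[RHS]Rplus_0_r; congr (_ + _).
    by apply: eq_rsum => a'; rewrite ea Q_ia; lra.
  by rewrite -(rsum0 Ob); apply: eq_rsum => b; rewrite eq_sym eab /=; lra.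
have pb b : pushfwd Q f (f (ib b)) = (1 - l) * pushfwd Qb fb (fb b).
  rewrite !pushfwdE rsum_split rsumMl -[RHS]Rplus_0_l; congr (_ + _).
    by rewrite -(rsum0 Oa); apply: eq_rsum => a; rewrite eab /=; lra.
  by apply: eq_rsum => b'; rewrite eb Q_ib; lra.
rewrite !ent_mean_log //; [|exact: Qb_pmf.1|exact: Qa_pmf.1].
rewrite rsum_split.
rewrite (@eq_rsum _ (fun a => Q (ia a) * _)
  (fun a => l * log2 l * Qa a + l * (Qa a * log2 (pushfwd Qa fa (fa a))))); last first.
  move=> a; rewrite pa Q_ia; case: (Rle_lt_or_eq_dec _ _ (Qa_pmf.1 a)) => [Qa0|<-]; last by lra.
  rewrite log2M; [lra| by lra |exact: (pushfwd_gt0 Qa_pmf.1)].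
rewrite (@eq_rsum _ (fun b => Q (ib b) * _)
  (fun b => (1 - l) * log2 (1 - l) * Qb b + (1 - l) * (Qb b * log2 (pushfwd Qb fb (fb b)))));
  last first.
  move=> b; rewrite pb Q_ib; case: (Rle_lt_or_eq_dec _ _ (Qb_pmf.1 b)) => [Qb0|<-]; last by lra.
  rewrite log2M; [lra| by lra |exact: (pushfwd_gt0 Qb_pmf.1)].
by rewrite !rsumD -!rsumMl Qa_pmf.2 Qb_pmf.2; lra.
Qed.

End Mixture.

Section TimeSharing.
Variables (X Y1 Y2 V1 V2 Va Vb : finType) (P : X * Y1 * Y2 -> R).
Variables (Wa : X -> Va * V1 * V2 -> R) (Wb : X -> Vb * V1 * V2 -> R) (l : R).
Hypotheses (P_pmf : is_pmf P) (Wa_chan : is_channel Wa) (Wb_chan : is_channel Wb).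
Hypothesis l01 : 0 < l < 1.

Definition mix_channel (x : X) (u : (Va + Vb) * V1 * V2) : R :=
  match u.1.1 with
  | inl a => l * Wa x (a, u.1.2, u.2)
  | inr b => (1 - l) * Wb x (b, u.1.2, u.2)
  end.

Let ia (w : (X * Y1 * Y2) * (Va * V1 * V2)) : (X * Y1 * Y2) * ((Va + Vb) * V1 * V2) :=
  (w.1, (inl w.2.1.1, w.2.1.2, w.2.2)).
Let ib (w : (X * Y1 * Y2) * (Vb * V1 * V2)) : (X * Y1 * Y2) * ((Va + Vb) * V1 * V2) :=
  (w.1, (inr w.2.1.1, w.2.1.2, w.2.2)).

Lemma rsum_mix_channel (F : (Va + Vb) * V1 * V2 -> R) :
  rsum F = (\rsum_(u : Va * V1 * V2) F (inl u.1.1, u.1.2, u.2))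
         + \rsum_(u : Vb * V1 * V2) F (inr u.1.1, u.1.2, u.2).
Proof. by rewrite !(rsum_pair, rsum_sum). Qed.

Lemma mix_channelP : is_channel mix_channel.
Proof.
move=> x; split.
  move=> [[[a|b] v1] v2]; apply: Rmult_le_pos; try lra.
    exact: (Wa_chan x).1.
  exact: (Wb_chan x).1.
rewrite rsum_mix_channel /mix_channel /=.
rewrite (@eq_rsum _ _ (fun u => l * Wa x u)); last by move=> [[? ?] ?].
rewrite [X in _ + X](@eq_rsum _ _ (fun u => (1 - l) * Wb x u)); last by move=> [[? ?] ?].
by rewrite -!rsumMl (Wa_chan x).2 (Wb_chan x).2; lra.
Qed.

Lemma mix_channel_marginals W1 W2 :
  marginals_ok Wa W1 W2 -> marginals_ok Wb W1 W2 -> marginals_ok mix_channel W1 W2.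
Proof.
move=> [ma1 ma2] [mb1 mb2]; split=> x v.
  have := ma1 x v; have := mb1 x v; rewrite !rsum_pair rsum_sum /= => hb ha.
  rewrite /mix_channel /=.
  rewrite (@eq_rsum _ _ (fun a => l * \rsum_b Wa x (a, v, b))); last by move=> a; rewrite rsumMl.
  rewrite [X in _ + X](@eq_rsum _ _ (fun a => (1 - l) * \rsum_b Wb x (a, v, b)));
    last by move=> a; rewrite rsumMl.
  by rewrite -!rsumMl ha hb; lra.
have := ma2 x v; have := mb2 x v; rewrite !rsum_pair rsum_sum /= => hb ha.
rewrite /mix_channel /=.
rewrite (@eq_rsum _ _ (fun a => l * \rsum_b Wa x (a, b, v))); last by move=> a; rewrite rsumMl.
rewrite [X in _ + X](@eq_rsum _ _ (fun a => (1 - l) * \rsum_b Wb x (a, b, v)));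
  last by move=> a; rewrite rsumMl.
by rewrite -!rsumMl ha hb; lra.
Qed.

Let Qm := joint P mix_channel.

Lemma ent_mix (A B C : finType) (fa : _ -> A) (fb : _ -> B) (f : _ -> C) :
  (forall w' w, (f (ia w') == f (ia w)) = (fa w' == fa w)) ->
  (forall w' w, (f (ib w') == f (ib w)) = (fb w' == fb w)) ->
  (forall w' w, (f (ia w') == f (ib w)) = false) ->
  ent Qm f = l * ent (joint P Wa) fa + (1 - l) * ent (joint P Wb) fb
             - l * log2 l - (1 - l) * log2 (1 - l).
Proof.
apply: ent_mixture => //.
- move=> F; rewrite (rsum_pair F) !(rsum_pair (fun w => F _)) -rsumD.
  by apply: eq_rsum => z; rewrite rsum_mix_channel.
- exact: joint_pmf.
- exact: joint_pmf.
- by move=> [z [[v0 v1] v2]]; rewrite /Qm /joint /mix_channel /=; lra.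
- by move=> [z [[v0 v1] v2]]; rewrite /Qm /joint /mix_channel /=; lra.
- exact/joint_ge0/mix_channelP.
Qed.

(** All four entropies contain [oV0], so the binary entropy of the time-sharing choice occurs twice
    with each sign and cancels. *)
Lemma cmi_mix_cond (A B : finType) (v : V1 * V2 -> A) (y : X * Y1 * Y2 -> B) :
  cmi Qm oX (fun w => v (oV1 w, oV2 w)) (fun w => (oV0 w, y w.1)) =
  l * cmi (joint P Wa) oX (fun w => v (oV1 w, oV2 w)) (fun w => (oV0 w, y w.1)) +
  (1 - l) * cmi (joint P Wb) oX (fun w => v (oV1 w, oV2 w)) (fun w => (oV0 w, y w.1)).
Proof.
rewrite /cmi /=.
rewrite (@ent_mix _ _ _ (fun w => (oX w, (oV0 w, y w.1)))
  (fun w => (oX w, (oV0 w, y w.1)))); [|by move=> w' w; rewrite !xpair_eqE ?andbF..].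
rewrite (@ent_mix _ _ _ (fun w => (v (oV1 w, oV2 w), (oV0 w, y w.1)))
  (fun w => (v (oV1 w, oV2 w), (oV0 w, y w.1))));
  [|by move=> w' w; rewrite !xpair_eqE ?andbF..].
rewrite (@ent_mix _ _ _ (fun w => (oX w, v (oV1 w, oV2 w), (oV0 w, y w.1)))
  (fun w => (oX w, v (oV1 w, oV2 w), (oV0 w, y w.1))));
  [|by move=> w' w; rewrite !xpair_eqE ?andbF..].
rewrite (@ent_mix _ _ _ (fun w => (oV0 w, y w.1)) (fun w => (oV0 w, y w.1)));
  [|by move=> w' w; rewrite !xpair_eqE ?andbF..].
by lra.
Qed.

(** The two entropies without [oV0] are entropies of the source [P] alone, hence equal for both
    components and for the mixture. In the other two the binary entropy of the choice occurs with
    opposite signs. *)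
Lemma cmi_mix (A B : finType) (v : V1 * V2 -> A) (y : X * Y1 * Y2 -> B) :
  cmi Qm oX (fun w => (oV0 w, v (oV1 w, oV2 w))) (fun w => y w.1) =
  l * cmi (joint P Wa) oX (fun w => (oV0 w, v (oV1 w, oV2 w))) (fun w => y w.1) +
  (1 - l) * cmi (joint P Wb) oX (fun w => (oV0 w, v (oV1 w, oV2 w))) (fun w => y w.1).
Proof.
rewrite /cmi /=.
have ey (U : finType) (W : X -> U * V1 * V2 -> R) (Wc : is_channel W) :
    (ent (joint P W) (fun w => y w.1) = ent P y) *
    (ent (joint P W) (fun w => (oX w, y w.1)) = ent P (fun z => (z.1.1, y z))).
  by rewrite -!(ent_joint P_pmf Wc).
rewrite !(ey _ _ Wa_chan) !(ey _ _ Wb_chan) !(ey _ _ mix_channelP).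
rewrite (@ent_mix _ _ _ (fun w => (oV0 w, v (oV1 w, oV2 w), y w.1))
  (fun w => (oV0 w, v (oV1 w, oV2 w), y w.1)));
  [|by move=> w' w; rewrite !xpair_eqE ?andbF..].
rewrite (@ent_mix _ _ _ (fun w => (oX w, (oV0 w, v (oV1 w, oV2 w)), y w.1))
  (fun w => (oX w, (oV0 w, v (oV1 w, oV2 w)), y w.1)));
  [|by move=> w' w; rewrite !xpair_eqE ?andbF..].
by lra.
Qed.

End TimeSharing.

(** At [l = 0] and [l = 1] the combination is one of the given points, so the hypothesis is asked
    only for interior [l], where both components of a mixture have positive weight and the
    logarithms of products split. *)
Lemma convex3_closure (S : R * R * R -> Prop) :
  (forall r r' l, S r -> S r' -> 0 < l < 1 ->
     S (l * r.1.1 + (1 - l) * r'.1.1, l * r.1.2 + (1 - l) * r'.1.2,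
        l * r.2 + (1 - l) * r'.2)) ->
  convex3 (closure3 S).
Proof.
move=> cS r r' l Sr Sr' l01 d d0.
have [s [Ss [h1 [h2 h3]]]] := Sr d d0; have [s' [Ss' [h1' [h2' h3']]]] := Sr' d d0.
case: (Rle_lt_or_eq_dec 0 l l01.1) => [l0|<-]; last first.
  by exists s' => /=; rewrite !Rmult_0_l !Rminus_0_r !Rmult_1_l !Rplus_0_l.
case: (Rle_lt_or_eq_dec l 1 l01.2) => [l1|->]; last first.
  by exists s => /=; rewrite !Rminus_diag !Rmult_0_l !Rmult_1_l !Rplus_0_r.
have comb a b a' b' : Rabs (a - b) < d -> Rabs (a' - b') < d ->
    Rabs (l * a + (1 - l) * a' - (l * b + (1 - l) * b')) < d.
  move=> /Rabs_def2 [u1 u2] /Rabs_def2 [w1 w2].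
  have -> : l * a + (1 - l) * a' - (l * b + (1 - l) * b') =
    l * (a - b) + (1 - l) * (a' - b') by lra.
  by apply: Rabs_def1; nra.
by exists (l * s.1.1 + (1 - l) * s'.1.1, l * s.1.2 + (1 - l) * s'.1.2,
        l * s.2 + (1 - l) * s'.2); split; [exact: cS | split; [|split] => /=; apply: comb].
Qed.

Lemma R_inner_convex (X Y1 Y2 V1 V2 : finType) (P : X * Y1 * Y2 -> R)
    (W1 : X -> V1 -> R) (W2 : X -> V2 -> R) :
  is_pmf P -> convex3 (R_inner P W1 W2).
Proof.
move=> P_pmf; apply: convex3_closure => r r' l.
move=> [r0 [r1 [r2 [Va [Wa [Wac [Wam [a1 [a2 [a3 a4]]]]]]]]]].
move=> [r0' [r1' [r2' [Vb [Wb [Wbc [Wbm [b1 [b2 [b3 b4]]]]]]]]]] l01.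
do 3![split; first by rewrite /=; nra].
exists (Va + Vb)%type, (mix_channel Wa Wb l); split; first exact: mix_channelP.
split; first exact: mix_channel_marginals.
have c1 := cmi_mix_cond P_pmf Wac Wbc l01 fst (fun z => z.1.2).
have c2 := cmi_mix_cond P_pmf Wac Wbc l01 snd snd.
have c3 := cmi_mix P_pmf Wac Wbc l01 fst (fun z => z.1.2).
have c4 := cmi_mix P_pmf Wac Wbc l01 snd snd.
have comb x x' a b c : c = l * a + (1 - l) * b -> x > a -> x' > b ->
    l * x + (1 - l) * x' > c by move=> -> ? ?; nra.
have sum a b a' b' : l * a + (1 - l) * a' + (l * b + (1 - l) * b') =
    l * (a + b) + (1 - l) * (a' + b') by lra.
split; first exact: (comb _ _ _ _ _ c1 a1 b1).
split; first exact: (comb _ _ _ _ _ c2 a2 b2).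
split; rewrite /= sum; first exact: (comb _ _ _ _ _ c3 a3 b3).
exact: (comb _ _ _ _ _ c4 a4 b4).
Qed.

(** * Random codebooks *)

Lemma rprod_rsum_ffun (A B : finType) (F : A -> B -> R) :
  \big[Rmult/1]_a rsum (F a) = \rsum_(o : {ffun A -> B}) \big[Rmult/1]_a F a (o a).
Proof. exact: bigA_distr_bigA. Qed.

Lemma rprod_if (A : finType) (a : A) (f : A -> R) :
  \big[Rmult/1]_x (if x == a then f x else 1) = f a.
Proof. by rewrite -big_mkcond big_pred1_eq. Qed.

Section UniformFunction.
Variables A B : finType.
Hypothesis B_gt0 : (0 < #|B|)%N.

Definition unif_ffun (o : {ffun A -> B}) : R := \big[Rmult/1]_(a : A) / INR #|B|.

Lemma rsum_uniform : (\rsum_(b : B) / INR #|B|) = 1.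
Proof. by rewrite rsum_const; apply: Rinv_r; apply: not_0_INR; case: #|B| B_gt0. Qed.

Lemma mean_unif_ffun (h : A -> B -> R) :
  (\rsum_o unif_ffun o * \big[Rmult/1]_a h a (o a)) =
  \big[Rmult/1]_a \rsum_b / INR #|B| * h a b.
Proof. by rewrite rprod_rsum_ffun; apply: eq_rsum => o; rewrite -big_split. Qed.

Lemma unif_ffun_pmf : is_pmf unif_ffun.
Proof.
have N0 : 0 < INR #|B| by apply/lt_0_INR/ltP.
split=> [o|].
  rewrite /unif_ffun; apply: (big_ind (fun x => 0 <= x)) => [|x y|a _]; first lra.
    exact: Rmult_le_pos.
  by apply: Rlt_le; apply: Rinv_0_lt_compat.
transitivity (\rsum_o unif_ffun o * \big[Rmult/1]_(a : A) 1).
  by apply: eq_rsum => o; rewrite [X in _ * X]big1 // Rmult_1_r.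
rewrite (mean_unif_ffun (fun _ _ => 1)) big1 // => a _.
by rewrite -{2}rsum_uniform; apply: eq_rsum => b; rewrite Rmult_1_r.
Qed.

Lemma mean_unif_ffun1 a (f : B -> R) :
  (\rsum_o unif_ffun o * f (o a)) = \rsum_b / INR #|B| * f b.
Proof.
(* Padding with factors 1 turns a function of one coordinate into a product over all of them, whose
   mean factorises. *)
transitivity (\rsum_o unif_ffun o * \big[Rmult/1]_x (if x == a then f (o x) else 1)).
  by apply: eq_rsum => o; rewrite (rprod_if a (fun x => f (o x))).
rewrite (mean_unif_ffun (fun x b => if x == a then f b else 1)).
rewrite -[RHS](rprod_if a (fun=> \rsum_b / INR #|B| * f b)).
apply: eq_bigr => x _; case: eqP => // _.
by rewrite -[RHS]rsum_uniform; apply: eq_rsum => b; lra.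
Qed.

Lemma mean_unif_ffun2 a a' (f g : B -> R) : a != a' ->
  (\rsum_o unif_ffun o * (f (o a) * g (o a'))) =
  (\rsum_b / INR #|B| * f b) * \rsum_b / INR #|B| * g b.
Proof.
move=> ne.
transitivity (\rsum_o unif_ffun o * \big[Rmult/1]_x
    ((if x == a then f (o x) else 1) * (if x == a' then g (o x) else 1))).
  apply: eq_rsum => o; rewrite big_split /= (rprod_if a (fun x => f (o x))).
  by rewrite (rprod_if a' (fun x => g (o x))).
rewrite (mean_unif_ffun (fun x b => (if x == a then f b else 1) *
  (if x == a' then g b else 1))).
rewrite -[in RHS](rprod_if a (fun=> \rsum_b / INR #|B| * f b)).
rewrite -[X in _ * X](rprod_if a' (fun=> \rsum_b / INR #|B| * g b)) -big_split /=.
apply: eq_bigr => x _; case: eqP => [->|_].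
  by rewrite (negbTE ne) Rmult_1_r; apply: eq_rsum => b; rewrite Rmult_1_r.
case: eqP => _; first by rewrite Rmult_1_l; apply: eq_rsum => b; rewrite Rmult_1_l.
by rewrite !Rmult_1_l -[RHS]rsum_uniform; apply: eq_rsum => b; rewrite Rmult_1_r.
Qed.

End UniformFunction.

(* [c o] is a random codebook containing each word with probability [p]; [k o]
   labels the words, [kap] being the probability that two labels coincide. *)
Definition random_code (O A K : finType) (rho : O -> R) (c : O -> A -> bool)
    (k : O -> A -> K) (p kap : R) : Prop :=
  [/\ is_pmf rho,
      forall a, (\rsum_o rho o * bR (c o a)) = p,
      forall a a', a != a' -> (\rsum_o rho o * (bR (c o a) * bR (c o a'))) = p * p &
      forall a a', a != a' ->
        (\rsum_o rho o * (bR (c o a) * bR (c o a') * bR (k o a' == k o a))) = p * p * kap].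

(** A uniform function into ['I_F * 'I_K] settles both choices at once: a word is kept when its
    first coordinate is [ord0], and its second coordinate is its label. *)
Lemma random_code_exists (A : finType) (F K : nat) : (0 < F)%N -> (0 < K)%N ->
  exists (O : finType) (rho : O -> R) (c : O -> A -> bool) (k : O -> A -> 'I_K),
    random_code rho c k (/ INR F) (/ INR K).
Proof.
case: F => // F _ K0; pose B : finType := ('I_F.+1 * 'I_K)%type.
have cB : #|B| = (F.+1 * K)%N by rewrite card_prod !card_ord.
have B0 : (0 < #|B|)%N by rewrite cB muln_gt0 K0.
have F0 : INR F.+1 <> 0 by apply: not_0_INR.
have K0' : INR K <> 0 by apply: not_0_INR => K00; rewrite K00 in K0.
have iB : / INR #|B| = / INR F.+1 * / INR K by rewrite cB mult_INR Rinv_mult.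
have mF : (\rsum_(b : B) / INR #|B| * bR (b.1 == ord0)) = / INR F.+1.
  rewrite rsum_pair iB /=.
  rewrite (@eq_rsum _ _ (fun f => bR (f == ord0) * / INR F.+1)); first by rewrite rsum_eq1.
  move=> f /=; rewrite rsum_const card_ord.
  by field.
have mFK j : (\rsum_(b : B) / INR #|B| * (bR (b.1 == ord0) * bR (b.2 == j))) =
    / INR F.+1 * / INR K.
  rewrite rsum_pair iB /=.
  rewrite (@eq_rsum _ _ (fun f => bR (f == ord0) * (/ INR F.+1 * / INR K)));
    first by rewrite rsum_eq1.
  move=> f /=.
  rewrite (@eq_rsum _ _ (fun i => bR (i == j) * (bR (f == ord0) * (/ INR F.+1 * / INR K))));
    first by rewrite rsum_eq1.
  by move=> i /=; lra.
exists {ffun A -> B}, (@unif_ffun A B),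
  (fun (o : {ffun A -> B}) a => (o a).1 == ord0), (fun (o : {ffun A -> B}) a => (o a).2).
split.
- exact: unif_ffun_pmf.
- by move=> a; rewrite (mean_unif_ffun1 B0 a (fun b => bR (b.1 == ord0))).
- move=> a a' ne.
  by rewrite (mean_unif_ffun2 B0 (fun b => bR (b.1 == ord0)) (fun b => bR (b.1 == ord0)) ne) mF.
- move=> a a' ne.
  (* Splitting by the common label [j] makes the event a product of one condition on [o a] and one
     on [o a']; the [K] equal terms then leave a single factor [/ INR K]. *)
  rewrite (@eq_rsum _ _ (fun o => \rsum_(j : 'I_K) unif_ffun o *
    ((bR ((o a).1 == ord0) * bR ((o a).2 == j)) *
     (bR ((o a').1 == ord0) * bR ((o a').2 == j))))); last first.
    move=> o /=; rewrite -rsumMl; congr (_ * _).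
    rewrite (@eq_rsum _ _ (fun j => bR (j == (o a).2) *
      (bR ((o a).1 == ord0) * (bR ((o a').1 == ord0) * bR ((o a').2 == j))))); last first.
      by move=> j /=; rewrite (eq_sym j); lra.
    by rewrite rsum_eq1 /=; lra.
  rewrite rsum_exchange.
  rewrite (@eq_rsum _ _ (fun=> (/ INR F.+1 * / INR K) * (/ INR F.+1 * / INR K))); last first.
    move=> j /=.
    by rewrite (mean_unif_ffun2 B0 (fun b => bR (b.1 == ord0) * bR (b.2 == j))
      (fun b => bR (b.1 == ord0) * bR (b.2 == j)) ne) mFK.
  by rewrite rsum_const card_ord; field.
Qed.

Lemma RlebP a b : reflect (a <= b) (Rleb a b).
Proof. by rewrite /Rleb; case: Rle_dec => h; constructor. Qed.

(** * Averages under a finite law *)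

Definition mean (O : finType) (rho f : O -> R) : R := \rsum_o rho o * f o.

Section Mean.
Variables (O : finType) (rho : O -> R).
Hypothesis rho_pmf : is_pmf rho.

Lemma eq_mean f g : (forall o, f o = g o) -> mean rho f = mean rho g.
Proof. by move=> h; apply: eq_rsum => o; rewrite h. Qed.

Lemma mean_le f g : (forall o, f o <= g o) -> mean rho f <= mean rho g.
Proof. by move=> h; apply: rsum_le => o; apply: Rmult_le_compat_l; [apply: rho_pmf.1|]. Qed.

Lemma meanD f g : mean rho (fun o => f o + g o) = mean rho f + mean rho g.
Proof. by rewrite -rsumD; apply: eq_rsum => o; lra. Qed.

Lemma meanMl c f : mean rho (fun o => c * f o) = c * mean rho f.
Proof. by rewrite /mean rsumMl; apply: eq_rsum => o; lra. Qed.

Lemma mean_const c : mean rho (fun=> c) = c.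
Proof. by rewrite /mean -rsumMr rho_pmf.2 Rmult_1_l. Qed.

Lemma mean_rsum (A : finType) (f : A -> O -> R) :
  mean rho (fun o => \rsum_a f a o) = \rsum_a mean rho (f a).
Proof.
rewrite /mean rsum_exchange; apply: eq_rsum => o; exact: rsumMl.
Qed.

Lemma exists_le_mean f M : mean rho f <= M -> exists o, f o <= M.
Proof.
move=> h; have [||o [_ ?]] := @exists_le_weighted_mean _ rho f M rho_pmf.1.
- by rewrite rho_pmf.2; lra.
- by rewrite rho_pmf.2 Rmult_1_r.
by exists o.
Qed.

End Mean.

Lemma mean_mul (O O' : finType) (rho f : O -> R) (rho' g : O' -> R) :
  mean rho (fun o => mean rho' (fun o' => f o * g o')) = mean rho f * mean rho' g.
Proof.
rewrite (eq_mean rho (fun o => meanMl rho' (f o) g)) {1}/mean {2}/mean rsumMr.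
by apply: eq_rsum => o; lra.
Qed.

(** * Covering by a random codebook: the second-moment method *)

Section Covering.
Variables (O A K V : finType) (rho : O -> R) (c : O -> A -> bool) (k : O -> A -> K).
Variables (p kap : R) (j : V -> A) (q : V -> R) (tau : R).
Hypotheses (code : random_code rho c k p kap) (j_inj : injective j) (p01 : 0 < p <= 1).
Hypotheses (q_pmf : is_pmf q) (tau_ge0 : 0 <= tau).

(** The kept mass has mean [p]. The set [C] is a pullback of a code along [j], which is the identity
    for the words [v0] and [v => (v0, v)] for the words over a fixed [v0]; one estimate thus serves
    both layers. *)
Definition thin_codebook (C : V -> bool) : bool := ~~ Rleb (p / 2) (\rsum_v q v * bR (C v)).

(* Chebyshev's inequality for the [q]-mass of the codebook, restricted to the
   letters of mass at most [tau]. *)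
Lemma mean_thin_codebook :
  mean rho (fun o => bR (thin_codebook (fun v => c o (j v)))) <=
  4 * ((/ p - 1) * tau + \rsum_v q v * bR (~~ Rleb (q v) tau)).
Proof.
have [rho_pmf c1 c2 _] := code; have q0 := q_pmf.1.
pose q' v := q v * bR (Rleb (q v) tau); pose s := rsum q'.
have q'0 v : 0 <= q' v by apply: Rmult_le_pos => //; apply: bR_ge0.
have q'q v : q' v <= q v.
  by rewrite /q'; have := bR_le1 (Rleb (q v) tau); have := q0 v; nra.
have q'tau v : q' v <= tau by rewrite /q'; case: RlebP => /= ?; lra.
have s01 : 0 <= s <= 1.
  by split; [apply: rsum_ge0 | rewrite -q_pmf.2; apply: rsum_le].
have s_compl : (\rsum_v q v * bR (~~ Rleb (q v) tau)) = 1 - s.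
  rewrite -q_pmf.2 -rsumB; apply: eq_rsum => v.
  by rewrite /q'; case: (Rleb _ _) => /=; lra.
pose U o := \rsum_v q' v * bR (c o (j v)).
have mU : mean rho U = p * s.
  rewrite /U mean_rsum // /s rsumMl; apply: eq_rsum => v.
  by rewrite meanMl; rewrite /mean c1; lra.
have mU2 : mean rho (fun o => U o * U o) = p * p * (s * s) + (p - p * p) * \rsum_v q' v * q' v.
  (* Pairwise independence gives [p * p] off the diagonal; the second sum corrects the diagonal,
     where the mean is [p]. *)
  transitivity (\rsum_v \rsum_v' q' v * q' v' * (p * p) +
      \rsum_v q' v * q' v * (p - p * p)).
    rewrite (@eq_mean _ _ _ (fun o => \rsum_v \rsum_v' q' v * q' v' *
        (bR (c o (j v)) * bR (c o (j v'))))); last first.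
      move=> o /=; rewrite /U rsumMr; apply: eq_rsum => v; rewrite rsumMl.
      by apply: eq_rsum => v'; lra.
    rewrite mean_rsum // -rsumD; apply: eq_rsum => v; rewrite mean_rsum //.
    rewrite (rsumD1 _ v) [X in _ = X + _](rsumD1 _ v).
    have -> : mean rho (fun o => q' v * q' v * (bR (c o (j v)) * bR (c o (j v)))) =
        q' v * q' v * p.
      rewrite meanMl -(c1 (j v)); congr (_ * _); apply: eq_mean => o.
      by case: (c o (j v)) => /=; lra.
    rewrite (@eq_rsum _ _ (fun v' => bR (v' != v) * (q' v * q' v' * (p * p)))); first by lra.
    move=> v' /=; case: eqP => [_|/eqP ne] /=; first by lra.
    rewrite meanMl /mean c2 //; apply: contra_neq ne => /j_inj //.
  rewrite -(rsumMr (p - p * p) (fun v => q' v * q' v)); congr (_ + _); last by lra.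
  rewrite /s rsumMr rsumMl; apply: eq_rsum => v.
  by rewrite !rsumMl; apply: eq_rsum => v'; lra.
(* The deviation is measured from [p] and not from the mean [p * s] of the truncated mass [U]. The
   bias [p * p * ((1 - s) * (1 - s))] is at most [p * p * (1 - s)], and [1 - s] is exactly the mass
   cut off. *)
have cheb o : bR (thin_codebook (fun v => c o (j v))) * (p * p) <=
    4 * (U o * U o + (- (2 * p)) * U o + p * p).
  rewrite /thin_codebook; case: RlebP => /= [_|/Rnot_le_lt h].
    by have := Rle_0_sqr (U o - p); rewrite /Rsqr; lra.
  have : U o < p / 2.
    apply: Rle_lt_trans h; apply: rsum_le => v; apply: Rmult_le_compat_r => //.
    exact: bR_ge0.
  by nra.
have := mean_le rho_pmf cheb.
rewrite meanMl !meanD meanMl mU mU2 mean_const //.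
rewrite (@eq_mean _ _ _ (fun o => p * p * bR (thin_codebook (fun v => c o (j v)))));
  last by move=> o /=; lra.
rewrite meanMl s_compl.
have sq : (\rsum_v q' v * q' v) <= tau.
  apply: (Rle_trans _ (tau * s)); last by nra.
  by rewrite /s rsumMl; apply: rsum_le => v; apply: Rmult_le_compat_r.
move: (mean _ _) => m hm.
have : p * p * m <= p * p * (4 * ((/ p - 1) * tau + (1 - s))).
  have -> : p * p * (4 * ((/ p - 1) * tau + (1 - s))) =
      4 * ((p - p * p) * tau + p * p * (1 - s)) by field; lra.
  have h1 : (p - p * p) * (\rsum_v q' v * q' v) <= (p - p * p) * tau.
    by apply: Rmult_le_compat_l => //; nra.
  have h2 : p * p * ((1 - s) * (1 - s)) <= p * p * (1 - s).
    by apply: Rmult_le_compat_l; nra.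
  by lra.
by apply: Rmult_le_reg_l; nra.
Qed.

End Covering.

(** The weight [q] restricted to [C] has total at least [p / 2], and some word of positive weight
    costs no more than the weighted mean. The bound is linear in membership, so that it can be
    averaged over the code. *)
Lemma exists_cheap_word (V : finType) (q g : V -> R) (C : V -> bool) (p : R) :
  (forall v, 0 <= q v) -> (forall v, 0 <= g v) -> 0 < p -> ~~ thin_codebook p q C ->
  exists v, C v /\ g v <= 2 / p * \rsum_v q v * (bR (C v) * g v).
Proof.
move=> q0 g0 p0; rewrite negbK => /RlebP hp.
set M := _ * _.
have [|||v [wv gv]] := @exists_le_weighted_mean _ (fun v => q v * bR (C v)) g M.
- by move=> v; apply: Rmult_le_pos => //; apply: bR_ge0.
- lra.
- have -> : (\rsum_v q v * bR (C v) * g v) = M * (p / 2).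
    rewrite (@eq_rsum _ _ (fun v => q v * (bR (C v) * g v))); last by move=> v /=; lra.
    by rewrite /M; field; lra.
  apply: Rmult_le_compat_l => //; apply: Rmult_le_pos;
    first by apply: Rlt_le; apply: Rdiv_lt_0_compat; lra.
  by apply: rsum_ge0 => v; apply: Rmult_le_pos => //; apply: Rmult_le_pos => //; apply: bR_ge0.
by exists v; split=> //; case: (C v) wv => //=; lra.
Qed.

(** * One receiver with a fixed code: decoding and its cost *)

Section Receiver.
Variables (X Y V0 V K0 K : finType) (P : X -> Y -> R) (q : X -> V0 -> V -> R).
Variables (T : X -> V -> bool) (S : V0 -> V -> Y -> bool) (vd : V).
Hypotheses (P_ge0 : forall x y, 0 <= P x y) (q_ge0 : forall x v0 v, 0 <= q x v0 v).

Section FixedCode.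
Variables (c0 : V0 -> bool) (k0 : V0 -> K0) (c : V0 * V -> bool) (k : V0 * V -> K) (p : R).

Definition candidate (j0 : K0) (j : K) (y : Y) (u : V0 * V) : bool :=
  [&& c0 u.1, c u, k0 u.1 == j0, k u == j & S u.1 u.2 y].

Definition decoder (j0 : K0) (j : K) (y : Y) : V :=
  if [pick u | candidate j0 j y u] is Some u then u.2 else vd.

Definition decoding_error (x : X) (j0 : K0) (j : K) : R :=
  \rsum_y P x y * bR (~~ T x (decoder j0 j y)).

Definition other_word (u u' : V0 * V) : bool := u' != u.

(** Wrong candidates are counted, not merely detected: this is the union bound, and its mean is a
    sum over pairs of words. *)
Definition clash (v0 : V0) (v : V) (y : Y) : R :=
  \rsum_u bR (other_word (v0, v) u) * bR (candidate (k0 v0) (k (v0, v)) y u).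

Definition word_cost (x : X) (v0 : V0) (v : V) : R :=
  \rsum_y P x y * (bR (~~ T x v) + bR (~~ S v0 v y) + clash v0 v y).

(** Bounds the error of the best [v] over [v0]: if the codebook over [v0] is thin the whole mass
    [rsum (P x)] of [x] is charged, otherwise the second term is the bound of
    [exists_cheap_word]. *)
Definition cloud_cost (x : X) (v0 : V0) : R :=
  rsum (P x) * bR (thin_codebook p (q x v0) (fun v => c (v0, v))) +
  2 / p * \rsum_v q x v0 v * (bR (c (v0, v)) * word_cost x v0 v).

Lemma clash_ge0 v0 v y : 0 <= clash v0 v y.
Proof. by apply: rsum_ge0 => u; apply: Rmult_le_pos; apply: bR_ge0. Qed.

Lemma word_cost_ge0 x v0 v : 0 <= word_cost x v0 v.
Proof.
apply: rsum_ge0 => y; apply: Rmult_le_pos => //.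
have := bR_ge0 (~~ T x v); have := bR_ge0 (~~ S v0 v y); have := clash_ge0 v0 v y; lra.
Qed.

Lemma decoding_error_le x j0 j : decoding_error x j0 j <= rsum (P x).
Proof.
apply: rsum_le => y; rewrite -[X in _ <= X]Rmult_1_r; apply: Rmult_le_compat_l => //.
exact: bR_le1.
Qed.

(** When [T] and [S] accept the true pair, it is a candidate, so the default [vd] is not reached; if
    another pair is picked, the clash count is at least 1. A wrong pair is charged even when its [v]
    would be acceptable. *)
Lemma decoding_error_word x v0 v : c0 v0 -> c (v0, v) ->
  decoding_error x (k0 v0) (k (v0, v)) <= word_cost x v0 v.
Proof.
move=> c0v cv; apply: rsum_le => y; apply: Rmult_le_compat_l => //.
have cl0 := clash_ge0 v0 v y.
case Tv: (T x v) => /=; last first.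
  have := bR_ge0 (~~ S v0 v y); have := bR_le1 (~~ T x (decoder (k0 v0) (k (v0, v)) y)); lra.
case Sv: (S v0 v y) => /=; last first.
  have := bR_le1 (~~ T x (decoder (k0 v0) (k (v0, v)) y)); lra.
rewrite /decoder; case: pickP => [u cu|/(_ (v0, v))]; last first.
  by rewrite /candidate /= c0v cv !eqxx Sv.
case: (eqVneq u (v0, v)) => [->|ne] /=; first by rewrite Tv /=; lra.
apply: (Rle_trans _ 1); first exact: bR_le1.
rewrite !Rplus_0_l.
apply: (Rle_trans _ (bR (other_word (v0, v) u) * bR (candidate (k0 v0) (k (v0, v)) y u))).
  by rewrite /other_word ne cu /=; lra.
apply: (@rsum_ge_term _ (fun u => bR (other_word (v0, v) u) * bR (candidate _ _ y u))) => b.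
by apply: Rmult_le_pos; apply: bR_ge0.
Qed.

Hypothesis p_gt0 : 0 < p.

Lemma cloud_cost_ge0 x v0 : 0 <= cloud_cost x v0.
Proof.
apply: Rplus_le_le_0_compat; apply: Rmult_le_pos.
- exact: rsum_ge0.
- exact: bR_ge0.
- by apply: Rlt_le; apply: Rdiv_lt_0_compat; lra.
apply: rsum_ge0 => v; apply: Rmult_le_pos => //; apply: Rmult_le_pos; first exact: bR_ge0.
exact: word_cost_ge0.
Qed.

Lemma exists_cloud_word x v0 : c0 v0 ->
  exists v, decoding_error x (k0 v0) (k (v0, v)) <= cloud_cost x v0.
Proof.
move=> c0v; rewrite /cloud_cost.
case thin : (thin_codebook _ _ _) => /=.
  (* The charge for a thin codebook already covers the whole mass of [x], so an arbitrary word will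
     do. *)
  exists vd; rewrite Rmult_1_r.
  have := decoding_error_le x (k0 v0) (k (v0, vd)).
  have h : 0 <= 2 / p * \rsum_v q x v0 v * (bR (c (v0, v)) * word_cost x v0 v).
    apply: Rmult_le_pos; first by apply: Rlt_le; apply: Rdiv_lt_0_compat; lra.
    apply: rsum_ge0 => v; apply: Rmult_le_pos => //; apply: Rmult_le_pos; first exact: bR_ge0.
    exact: word_cost_ge0.
  by lra.
have [v [cv hv]] := exists_cheap_word (q_ge0 x v0) (word_cost_ge0 x v0) p_gt0 (negbT thin).
by exists v; have := decoding_error_word x c0v cv; lra.
Qed.

End FixedCode.
End Receiver.

(** * The cost averaged over the random codes *)

Section MeanCost.
Variables (X Y V0 V K0 K O0 O : finType) (P : X -> Y -> R) (q : X -> V0 -> V -> R).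
Variables (T : X -> V -> bool) (S : V0 -> V -> Y -> bool).
Variables (rho0 : O0 -> R) (c0 : O0 -> V0 -> bool) (k0 : O0 -> V0 -> K0) (p0 kap0 : R).
Variables (rho : O -> R) (c : O -> V0 * V -> bool) (k : O -> V0 * V -> K) (p kap : R).
Variables (N N0 tau : R).
Hypotheses (P_ge0 : forall x y, 0 <= P x y) (q_ge0 : forall x v0 v, 0 <= q x v0 v).
Hypotheses (code0 : random_code rho0 c0 k0 p0 kap0) (code : random_code rho c k p kap).
Hypotheses (p0_gt0 : 0 < p0) (p01 : 0 < p <= 1) (kap0_ge0 : 0 <= kap0) (kap_ge0 : 0 <= kap).
Hypotheses (S_cond : forall v0 y, (\rsum_v bR (S v0 v y)) <= N)
  (S_joint : forall y, (\rsum_v0 \rsum_v bR (S v0 v y)) <= N0).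
Hypothesis tau_ge0 : 0 <= tau.

Definition clash_rate : R := p * kap * N + p0 * p * kap0 * kap * N0.

(** The two layers are independent. A wrong pair always has a second-layer entry different from that
    of [(v0, v)], which gives [p * p * kap]. In the first layer a pair with the same [v0] agrees for
    free, leaving [p0], while another [v0] costs [p0 * p0 * kap0]. The accepted pairs of the two
    kinds are counted by [S_cond] and [S_joint]. *)
Lemma mean_clash v0 v y :
  mean rho0 (fun o0 => mean rho (fun o =>
    bR (c0 o0 v0) * (bR (c o (v0, v)) * clash S (c0 o0) (k0 o0) (c o) (k o) v0 v y)))
  <= p0 * p * clash_rate.
Proof.
have [rho0_pmf c01 _ c03] := code0; have [rho_pmf c1 _ c3] := code.
pose A o0 u := bR (c0 o0 v0) * bR (c0 o0 u) * bR (k0 o0 u == k0 o0 v0).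
pose B o u := bR (c o (v0, v)) * bR (c o u) * bR (k o u == k o (v0, v)).
pose w u := bR (other_word (v0, v) u) * bR (S u.1 u.2 y).
rewrite (@eq_mean _ _ _ (fun o0 => \rsum_u w u * mean rho (fun o => A o0 u.1 * B o u)));
  last first.
  move=> o0 /=; rewrite (@eq_mean _ _ _ (fun o => \rsum_u w u * (A o0 u.1 * B o u))).
    by rewrite mean_rsum //; apply: eq_rsum => u; rewrite meanMl.
  move=> o /=; rewrite /clash !rsumMl; apply: eq_rsum => u.
  by rewrite /A /B /w /candidate !bRM /=; ring.
rewrite mean_rsum //.
rewrite (@eq_rsum _ _ (fun u => w u * (mean rho0 (A^~ u.1) * mean rho (B^~ u))));
  last by move=> u; rewrite meanMl mean_mul.
have pk : 0 <= p * p * kap by do ![apply: Rmult_le_pos => //]; lra.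
have pk0 : 0 <= p0 * p0 * kap0 by do ![apply: Rmult_le_pos => //]; lra.
(* Charging both rates when [u.1 = v0], and also charging the true pair, only enlarges the sum and
   makes it run over all accepted pairs. *)
apply: (Rle_trans _ (\rsum_u bR (S u.1 u.2 y) *
    ((bR (u.1 == v0) * p0 + p0 * p0 * kap0) * (p * p * kap)))).
  apply: rsum_le => u; rewrite /w /other_word.
  case: (eqVneq u (v0, v)) => [_|ne] /=.
    rewrite !Rmult_0_l; apply: Rmult_le_pos; first exact: bR_ge0.
    apply: Rmult_le_pos => //; have := bR_ge0 (u.1 == v0); nra.
  rewrite Rmult_1_l; apply: Rmult_le_compat_l; first exact: bR_ge0.
  have -> : mean rho (B^~ u) = p * p * kap by apply: c3; rewrite eq_sym.
  apply: Rmult_le_compat_r => //.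
  case: (eqVneq u.1 v0) => [->|ne0] /=; last first.
    by have -> : mean rho0 (A^~ u.1) = p0 * p0 * kap0; [apply: c03; rewrite eq_sym | lra].
  suff -> : mean rho0 (A^~ v0) = p0 by lra.
  rewrite -(c01 v0); apply: eq_mean => o0; rewrite /A eqxx.
  by case: (c0 o0 v0) => /=; lra.
have -> : (\rsum_u bR (S u.1 u.2 y) * ((bR (u.1 == v0) * p0 + p0 * p0 * kap0) * (p * p * kap))) =
    p0 * p * (p * kap * (\rsum_v bR (S v0 v y)) +
      p0 * p * kap0 * kap * \rsum_u bR (S u.1 u.2 y)).
  rewrite -(rsum_eq1 (fun v0 => \rsum_v bR (S v0 v y)) v0).
  rewrite (@eq_rsum _ (fun b => bR (b == v0) * _) (fun b => \rsum_a bR (b == v0) * bR (S b a y)));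
    last by move=> b /=; rewrite rsumMl.
  rewrite -(rsum_pair (fun u => bR (u.1 == v0) * bR (S u.1 u.2 y))).
  rewrite !rsumMl -rsumD rsumMl; apply: eq_rsum => u; lra.
rewrite /clash_rate; apply: Rmult_le_compat_l; first by nra.
apply: Rplus_le_compat; apply: Rmult_le_compat_l => //.
- by apply: Rmult_le_pos => //; lra.
- by do ![apply: Rmult_le_pos => //]; lra.
by rewrite rsum_pair.
Qed.

Lemma mean_cloud_cost x v0 : is_pmf (q x v0) ->
  mean rho0 (fun o0 => mean rho (fun o =>
    bR (c0 o0 v0) * cloud_cost P q T S (c0 o0) (k0 o0) (c o) (k o) p x v0)) <=
  p0 * (rsum (P x) * (4 * ((/ p - 1) * tau + \rsum_v q x v0 v * bR (~~ Rleb (q x v0 v) tau))) +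
    2 * \rsum_v q x v0 v * \rsum_y P x y * (bR (~~ T x v) + bR (~~ S v0 v y) + clash_rate)).
Proof.
move=> qx_pmf; have [rho0_pmf c01 _ _] := code0; have [rho_pmf c1 _ _] := code.
pose G o0 o v y := bR (c0 o0 v0) * (bR (c o (v0, v)) *
   (bR (~~ T x v) + bR (~~ S v0 v y) + clash S (c0 o0) (k0 o0) (c o) (k o) v0 v y)).
pose thin o := bR (thin_codebook p (q x v0) (fun v => c o (v0, v))).
rewrite (@eq_mean _ _ _ (fun o0 => mean rho (fun o => bR (c0 o0 v0) * (rsum (P x) * thin o)) +
   2 / p * \rsum_v q x v0 v * \rsum_y P x y * mean rho (fun o => G o0 o v y))); last first.
  move=> o0 /=.
  rewrite (@eq_mean _ _ _ (fun o => bR (c0 o0 v0) * (rsum (P x) * thin o) +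
    2 / p * \rsum_v q x v0 v * \rsum_y P x y * G o0 o v y)); last first.
    move=> o /=; rewrite /cloud_cost Rmult_plus_distr_l; congr (_ + _).
    rewrite Rmult_comm Rmult_assoc; congr (_ * _); rewrite rsumMr; apply: eq_rsum => v.
    rewrite /word_cost Rmult_assoc; congr (_ * _); rewrite rsumMl rsumMr; apply: eq_rsum => y.
    by rewrite /G; lra.
  rewrite meanD; congr (_ + _); rewrite meanMl; congr (_ * _).
  rewrite mean_rsum //; apply: eq_rsum => v; rewrite meanMl mean_rsum //; congr (_ * _).
  by apply: eq_rsum => y; rewrite meanMl.
rewrite meanD mean_mul !meanMl Rmult_plus_distr_l; apply: Rplus_le_compat.
  have -> : mean rho0 (fun o0 => bR (c0 o0 v0)) = p0 by exact: c01.
  apply: Rmult_le_compat_l; first lra.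
  apply: Rmult_le_compat_l; first exact: rsum_ge0.
  by apply: (mean_thin_codebook code) => // v v' [].
(* The factor [/ p] from [exists_cheap_word] is to be cancelled by the probability [p] that
   [(v0, v)] is kept. *)
rewrite (_ : p0 * _ = 2 / p * (p0 * p * \rsum_v q x v0 v * \rsum_y P x y *
  (bR (~~ T x v) + bR (~~ S v0 v y) + clash_rate))); last by field; lra.
apply: Rmult_le_compat_l; first by apply: Rlt_le; apply: Rdiv_lt_0_compat; lra.
rewrite mean_rsum // rsumMl; apply: rsum_le => v.
rewrite meanMl (Rmult_comm (p0 * p)) Rmult_assoc; apply: Rmult_le_compat_l => //.
rewrite mean_rsum // rsumMr; apply: rsum_le => y.
rewrite meanMl Rmult_assoc; apply: Rmult_le_compat_l => //.
rewrite (@eq_mean _ _ _ (fun o0 => mean rho (fun o => bR (c0 o0 v0) * (bR (c o (v0, v)) *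
    (bR (~~ T x v) + bR (~~ S v0 v y)))) + mean rho (fun o => bR (c0 o0 v0) *
    (bR (c o (v0, v)) * clash S (c0 o0) (k0 o0) (c o) (k o) v0 v y)))); last first.
  by move=> o0 /=; rewrite -meanD; apply: eq_mean => o; rewrite /G; lra.
rewrite meanD mean_mul.
have -> : mean rho0 (fun o0 => bR (c0 o0 v0)) = p0 by exact: c01.
have -> : mean rho (fun o => bR (c o (v0, v)) * (bR (~~ T x v) + bR (~~ S v0 v y))) =
    p * (bR (~~ T x v) + bR (~~ S v0 v y)).
  by rewrite /mean -(c1 (v0, v)) rsumMr; apply: eq_rsum => o; lra.
by have := mean_clash v0 v y; lra.
Qed.

End MeanCost.

Lemma mean3_split (X V O0 O1 O2 : finType) (r0 : O0 -> R) (r1 : O1 -> R) (r2 : O2 -> R)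
    (A : X -> O0 -> R) (w : X -> V -> R)
    (B : X -> V -> O0 -> O1 -> R) (C : X -> V -> O0 -> O2 -> R) :
  is_pmf r0 -> is_pmf r1 -> is_pmf r2 ->
  mean r0 (fun o0 => mean r1 (fun o1 => mean r2 (fun o2 =>
    \rsum_x (A x o0 + \rsum_v w x v * (B x v o0 o1 + C x v o0 o2))))) =
  \rsum_x (mean r0 (A x) + \rsum_v w x v *
    (mean r0 (fun o0 => mean r1 (B x v o0)) + mean r0 (fun o0 => mean r2 (C x v o0)))).
Proof.
move=> h0 h1 h2.
transitivity (mean r0 (fun o0 => \rsum_x (A x o0 + \rsum_v w x v *
    (mean r1 (B x v o0) + mean r2 (C x v o0))))); last first.
  rewrite mean_rsum //; apply: eq_rsum => x; rewrite meanD; congr (_ + _).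
  by rewrite mean_rsum //; apply: eq_rsum => v; rewrite meanMl meanD.
apply: eq_mean => o0.
transitivity (mean r1 (fun o1 => \rsum_x (A x o0 + \rsum_v w x v *
    (B x v o0 o1 + mean r2 (C x v o0))))); last first.
  rewrite mean_rsum //; apply: eq_rsum => x; rewrite meanD mean_const //; congr (_ + _).
  by rewrite mean_rsum //; apply: eq_rsum => v; rewrite meanMl meanD mean_const.
apply: eq_mean => o1.
rewrite mean_rsum //; apply: eq_rsum => x; rewrite meanD mean_const //; congr (_ + _).
by rewrite mean_rsum //; apply: eq_rsum => v; rewrite meanMl meanD mean_const.
Qed.

(** * One-shot coding *)

Section ReceiverLaw.
Variables (X Y V0 V : finType).
Variables (px : X -> R) (q0 : X -> V0 -> R) (P : X -> Y -> R) (q : X -> V0 -> V -> R).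

(* When [q0 x v0 = 0] the row [q x v0] is irrelevant and may vanish. *)
Record receiver_ok : Prop := ReceiverOk {
  px_pmf : is_pmf px;
  q0_pmf : forall x, is_pmf (q0 x);
  P_nonneg : forall x y, 0 <= P x y;
  P_marg : forall x, rsum (P x) = px x;
  q_nonneg : forall x v0 v, 0 <= q x v0 v;
  q_cond : forall x v0, 0 < q0 x v0 -> rsum (q x v0) = 1 }.

Definition rlaw (z : X * Y * V0 * V) : R :=
  P z.1.1.1 z.1.1.2 * q0 z.1.1.1 z.1.2 * q z.1.1.1 z.1.2 z.2.

Hypothesis ok : receiver_ok.

Lemma mean_rlaw (f : X * Y * V0 * V -> R) :
  mean rlaw f = \rsum_x \rsum_v0 q0 x v0 * \rsum_v q x v0 v * \rsum_y P x y * f (x, y, v0, v).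
Proof.
rewrite /mean !rsum_pair /rlaw /=; apply: eq_rsum => x.
rewrite rsum_exchange; apply: eq_rsum => v0.
rewrite rsum_exchange rsumMl; apply: eq_rsum => v.
by rewrite !rsumMl; apply: eq_rsum => y; lra.
Qed.

Lemma mean_rlaw_cloud (g : X -> V0 -> R) :
  mean rlaw (fun z => g z.1.1.1 z.1.2) = \rsum_x px x * \rsum_v0 q0 x v0 * g x v0.
Proof.
rewrite mean_rlaw; apply: eq_rsum => x; rewrite rsumMl; apply: eq_rsum => v0 /=.
rewrite (@eq_rsum _ _ (fun v => q x v0 v * (px x * g x v0))); last first.
  by move=> v /=; rewrite -rsumMr (P_marg ok).
case: (Rle_lt_or_eq_dec _ _ ((q0_pmf ok x).1 v0)) => [h|<-]; last by lra.
by rewrite -rsumMr (q_cond ok h); lra.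
Qed.

Lemma rlaw_pmf : is_pmf rlaw.
Proof.
split=> [z|].
  rewrite /rlaw; apply: Rmult_le_pos; last exact: (q_nonneg ok).
  by apply: Rmult_le_pos; [apply: (P_nonneg ok) | apply: (q0_pmf ok _).1].
transitivity (mean rlaw (fun=> 1)); first by apply: eq_rsum => z; lra.
rewrite (mean_rlaw_cloud (fun _ _ => 1)) -[RHS](px_pmf ok).2; apply: eq_rsum => x.
rewrite (@eq_rsum _ _ (q0 x)); last by move=> v /=; lra.
by rewrite (q0_pmf ok x).2; lra.
Qed.

End ReceiverLaw.

Section OneShot.
Variables (X V0 Y1 V1 Y2 V2 : finType) (F0 F1 F2 K0 K1 K2 : nat).
Variables (px : X -> R) (q0 : X -> V0 -> R).
Variables (P1 : X -> Y1 -> R) (q1 : X -> V0 -> V1 -> R) (T1 : X -> V1 -> bool).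
Variables (P2 : X -> Y2 -> R) (q2 : X -> V0 -> V2 -> R) (T2 : X -> V2 -> bool).
Variables (S1 : V0 -> V1 -> Y1 -> bool) (S2 : V0 -> V2 -> Y2 -> bool).
Variables (N1 N01 N2 N02 tau0 tau1 tau2 : R) (vd0 : V0) (vd1 : V1) (vd2 : V2).
Hypotheses (ok1 : receiver_ok px q0 P1 q1) (ok2 : receiver_ok px q0 P2 q2).
Hypotheses (F0_gt0 : (0 < F0)%N) (F1_gt0 : (0 < F1)%N) (F2_gt0 : (0 < F2)%N).
Hypotheses (K0_gt0 : (0 < K0)%N) (K1_gt0 : (0 < K1)%N) (K2_gt0 : (0 < K2)%N).
Hypotheses (S1_cond : forall v0 y, (\rsum_v bR (S1 v0 v y)) <= N1)
  (S1_joint : forall y, (\rsum_v0 \rsum_v bR (S1 v0 v y)) <= N01).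
Hypotheses (S2_cond : forall v0 y, (\rsum_v bR (S2 v0 v y)) <= N2)
  (S2_joint : forall y, (\rsum_v0 \rsum_v bR (S2 v0 v y)) <= N02).
Hypotheses (tau0_ge0 : 0 <= tau0) (tau1_ge0 : 0 <= tau1) (tau2_ge0 : 0 <= tau2).

(* [K0], [K] are the numbers of labels; a word is kept with probability [/ F0], [/ F]. *)
Definition receiver_bound (Y V : finType) (P : X -> Y -> R) (q : X -> V0 -> V -> R)
    (T : X -> V -> bool) (S : V0 -> V -> Y -> bool) (F K : nat) (N N0 tau : R) : R :=
  8 * ((INR F - 1) * tau) +
  4 * clash_rate (/ INR F0) (/ INR K0) (/ INR F) (/ INR K) N N0 +
  mean (rlaw q0 P q) (fun z => 8 * bR (~~ Rleb (q z.1.1.1 z.1.2 z.2) tau) +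
    4 * bR (~~ T z.1.1.1 z.2) + 4 * bR (~~ S z.1.2 z.2 z.1.1.2)).

(** Collects the averaged cloud costs into one expectation under [rlaw], the form to which the law
    of large numbers applies. The outer 2 comes from selecting [v0]; with the 4 of Chebyshev's
    inequality it makes 8, with the 2 from selecting [v] it makes 4. *)
Lemma receiver_boundE (Y V : finType) (P : X -> Y -> R) (q : X -> V0 -> V -> R)
    (T : X -> V -> bool) (S : V0 -> V -> Y -> bool) (F K : nat) (N N0 tau : R) :
  receiver_ok px q0 P q ->
  (\rsum_x \rsum_v0 q0 x v0 * (2 * (rsum (P x) * (4 * ((INR F - 1) * tau +
     \rsum_v q x v0 v * bR (~~ Rleb (q x v0 v) tau))) +
    2 * \rsum_v q x v0 v * \rsum_y P x y * (bR (~~ T x v) + bR (~~ S v0 v y) +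
     clash_rate (/ INR F0) (/ INR K0) (/ INR F) (/ INR K) N N0)))) =
  receiver_bound P q T S F K N N0 tau.
Proof.
move=> ok; rewrite /receiver_bound; set D := clash_rate _ _ _ _ _ _.
set a := (INR F - 1) * tau.
rewrite -[X in X + mean _ _](mean_const (rlaw_pmf ok)) -meanD mean_rlaw.
apply: eq_rsum => x; apply: eq_rsum => v0 /=.
case: (Rle_lt_or_eq_dec _ _ ((q0_pmf ok x).1 v0)) => [h|<-]; last by lra.
congr (_ * _); pose sg v := \rsum_y P x y * bR (~~ S v0 v y).
rewrite [in LHS](@eq_rsum _ (fun v => _ * \rsum_y _)
  (fun v => q x v0 v * (rsum (P x) * (bR (~~ T x v) + D) + sg v))); last first.
  move=> v /=; congr (_ * _); rewrite rsumMr /sg -rsumD; apply: eq_rsum => y; lra.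
rewrite [RHS](@eq_rsum _ _ (fun v => 8 * rsum (P x) * a * q x v0 v +
   (8 * rsum (P x) * (q x v0 v * bR (~~ Rleb (q x v0 v) tau)) +
   4 * (q x v0 v * (rsum (P x) * (bR (~~ T x v) + D) + sg v))))); last first.
  move=> v /=.
  rewrite (@eq_rsum _ _ (fun y => P x y * (8 * a + 4 * D + 8 * bR (~~ Rleb (q x v0 v) tau) +
     4 * bR (~~ T x v)) + 4 * (P x y * bR (~~ S v0 v y)))); last by move=> y /=; lra.
  by rewrite rsumD -rsumMr -rsumMl -/(sg v); lra.
by rewrite !rsumD -!rsumMl (q_cond ok h); lra.
Qed.

Lemma one_shot_coding :
  exists (enc : X -> 'I_K0 * 'I_K1 * 'I_K2) (dec1 : 'I_K0 -> 'I_K1 -> Y1 -> V1)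
    (dec2 : 'I_K0 -> 'I_K2 -> Y2 -> V2),
  (\rsum_x \rsum_y P1 x y * bR (~~ T1 x (dec1 (enc x).1.1 (enc x).1.2 y))) +
  (\rsum_x \rsum_y P2 x y * bR (~~ T2 x (dec2 (enc x).1.1 (enc x).2 y))) <=
  8 * ((INR F0 - 1) * tau0) +
  8 * mean (rlaw q0 P1 q1) (fun z => bR (~~ Rleb (q0 z.1.1.1 z.1.2) tau0)) +
  receiver_bound P1 q1 T1 S1 F1 K1 N1 N01 tau1 +
  receiver_bound P2 q2 T2 S2 F2 K2 N2 N02 tau2.
Proof.
have inv01 n : (0 < n)%N -> 0 < / INR n <= 1.
  move=> n0; have h : 1 <= INR n by apply: (le_INR 1); apply/leP.
  by split; [apply: Rinv_0_lt_compat | rewrite -Rinv_1; apply: Rinv_le_contravar]; lra.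
have [O0 [rho0 [c0 [k0 code0]]]] := random_code_exists V0 F0_gt0 K0_gt0.
have [O1 [rho1 [c1 [k1 code1]]]] := random_code_exists (V0 * V1)%type F1_gt0 K1_gt0.
have [O2 [rho2 [c2 [k2 code2]]]] := random_code_exists (V0 * V2)%type F2_gt0 K2_gt0.
have [i0 i1 i2] := And3 (inv01 _ F0_gt0) (inv01 _ F1_gt0) (inv01 _ F2_gt0).
have [j0 j1 j2] := And3 (inv01 _ K0_gt0) (inv01 _ K1_gt0) (inv01 _ K2_gt0).
have [rho0_pmf _ _ _] := code0; have [rho1_pmf _ _ _] := code1.
have [rho2_pmf _ _ _] := code2.
(* If the codebook of words [v0] is thin, each of the two receivers may fail on the whole mass
   [px x]. *)
pose A x o0 := 2 * px x * bR (thin_codebook (/ INR F0) (q0 x) (c0 o0)).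
pose B x v0 o0 o1 := bR (c0 o0 v0) *
  cloud_cost P1 q1 T1 S1 (c0 o0) (k0 o0) (c1 o1) (k1 o1) (/ INR F1) x v0.
pose C x v0 o0 o2 := bR (c0 o0 v0) *
  cloud_cost P2 q2 T2 S2 (c0 o0) (k0 o0) (c2 o2) (k2 o2) (/ INR F2) x v0.
pose w x v0 := 2 / (/ INR F0) * q0 x v0.
pose bound := 8 * ((INR F0 - 1) * tau0) +
  8 * mean (rlaw q0 P1 q1) (fun z => bR (~~ Rleb (q0 z.1.1.1 z.1.2) tau0)) +
  receiver_bound P1 q1 T1 S1 F1 K1 N1 N01 tau1 +
  receiver_bound P2 q2 T2 S2 F2 K2 N2 N02 tau2.
have mean_total : mean rho0 (fun o0 => mean rho1 (fun o1 => mean rho2 (fun o2 =>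
    \rsum_x (A x o0 + \rsum_v w x v * (B x v o0 o1 + C x v o0 o2))))) <= bound.
  rewrite mean3_split // rsumD.
  rewrite (@eq_rsum _ (fun x => \rsum_v w x v * _) (fun x =>
    (\rsum_v w x v * mean rho0 (fun o0 => mean rho1 (B x v o0))) +
    \rsum_v w x v * mean rho0 (fun o0 => mean rho2 (C x v o0)))); last first.
    by move=> x /=; rewrite -rsumD; apply: eq_rsum => v; lra.
  rewrite rsumD -Rplus_assoc /bound.
  have iiF0 : / / INR F0 = INR F0 by exact: Rinv_inv.
  have iiF1 : / / INR F1 = INR F1 by exact: Rinv_inv.
  have iiF2 : / / INR F2 = INR F2 by exact: Rinv_inv.
  apply: Rplus_le_compat; first apply: Rplus_le_compat.
  - rewrite (mean_rlaw_cloud ok1 (fun x v0 => bR (~~ Rleb (q0 x v0) tau0))).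
    have -> : 8 * ((INR F0 - 1) * tau0) = \rsum_x px x * (8 * ((INR F0 - 1) * tau0)).
      by rewrite -rsumMr (px_pmf ok1).2; lra.
    rewrite rsumMl -rsumD; apply: rsum_le => x; rewrite /A meanMl.
    have := mean_thin_codebook code0 (@inj_id V0) i0 (q0_pmf ok1 x) tau0_ge0.
    rewrite iiF0; have := (px_pmf ok1).1 x.
    move: (\rsum_v _) => s p0 h.
    have -> : px x * (8 * ((INR F0 - 1) * tau0)) + 8 * (px x * s) =
      2 * px x * (4 * ((INR F0 - 1) * tau0 + s)) by lra.
    by apply: Rmult_le_compat_l h; lra.
  - rewrite -(receiver_boundE _ _ _ _ _ _ _ ok1); apply: rsum_le => x; apply: rsum_le => v0.
    case: (Rle_lt_or_eq_dec _ _ ((q0_pmf ok1 x).1 v0)) => [h|e]; last first.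
      by rewrite /w -e; lra.
    have := mean_cloud_cost (P := P1) (q := q1) (S := S1) (tau := tau1) T1
      (P_nonneg ok1) (q_nonneg ok1) code0 code1 i0.1 i1 (Rlt_le _ _ j0.1) (Rlt_le _ _ j1.1)
      S1_cond S1_joint tau1_ge0 (conj (q_nonneg ok1 x v0) (q_cond ok1 h)).
    rewrite iiF1; set m := mean _ _; set b := (X in _ * X) => hm.
    have -> : q0 x v0 * (2 * b) = w x v0 * (/ INR F0 * b).
      by rewrite /w; field => e; rewrite e Rinv_0 in i0; lra.
    apply: Rmult_le_compat_l hm; apply: Rmult_le_pos; last by lra.
    by apply: Rlt_le; apply: Rdiv_lt_0_compat; lra.
  - rewrite -(receiver_boundE _ _ _ _ _ _ _ ok2); apply: rsum_le => x; apply: rsum_le => v0.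
    case: (Rle_lt_or_eq_dec _ _ ((q0_pmf ok2 x).1 v0)) => [h|e]; last first.
      by rewrite /w -e; lra.
    have := mean_cloud_cost (P := P2) (q := q2) (S := S2) (tau := tau2) T2
      (P_nonneg ok2) (q_nonneg ok2) code0 code2 i0.1 i2 (Rlt_le _ _ j0.1) (Rlt_le _ _ j2.1)
      S2_cond S2_joint tau2_ge0 (conj (q_nonneg ok2 x v0) (q_cond ok2 h)).
    rewrite iiF2; set m := mean _ _; set b := (X in _ * X) => hm.
    have -> : q0 x v0 * (2 * b) = w x v0 * (/ INR F0 * b).
      by rewrite /w; field => e; rewrite e Rinv_0 in i0; lra.
    apply: Rmult_le_compat_l hm; apply: Rmult_le_pos; last by lra.
    by apply: Rlt_le; apply: Rdiv_lt_0_compat; lra.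
(* Derandomisation: the bound on the iterated mean survives fixing the three codes in turn. *)
have [o0 {}mean_total] := exists_le_mean rho0_pmf mean_total.
have [o1 {}mean_total] := exists_le_mean rho1_pmf mean_total.
have [o2 {}mean_total] := exists_le_mean rho2_pmf mean_total.
pose cost1 := cloud_cost P1 q1 T1 S1 (c0 o0) (k0 o0) (c1 o1) (k1 o1) (/ INR F1).
pose cost2 := cloud_cost P2 q2 T2 S2 (c0 o0) (k0 o0) (c2 o2) (k2 o2) (/ INR F2).
pose err1 := decoding_error P1 T1 S1 vd1 (c0 o0) (k0 o0) (c1 o1) (k1 o1).
pose err2 := decoding_error P2 T2 S2 vd2 (c0 o0) (k0 o0) (c2 o2) (k2 o2).
have select1 x v0 : c0 o0 v0 -> exists v, err1 x (k0 o0 v0) (k1 o1 (v0, v)) <= cost1 x v0.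
  move=> cv; apply: exists_cloud_word cv;
    [exact: (P_nonneg ok1) | exact: (q_nonneg ok1) | exact: i1.1].
have select2 x v0 : c0 o0 v0 -> exists v, err2 x (k0 o0 v0) (k2 o2 (v0, v)) <= cost2 x v0.
  move=> cv; apply: exists_cloud_word cv;
    [exact: (P_nonneg ok2) | exact: (q_nonneg ok2) | exact: i2.1].
have select x : exists m : 'I_K0 * 'I_K1 * 'I_K2, err1 x m.1.1 m.1.2 + err2 x m.1.1 m.2 <=
    A x o0 + \rsum_v w x v * (B x v o0 o1 + C x v o0 o2).
  have e : (\rsum_v w x v * (B x v o0 o1 + C x v o0 o2)) =
      2 / (/ INR F0) * \rsum_v q0 x v * (bR (c0 o0 v) * (cost1 x v + cost2 x v)).
    by rewrite rsumMl; apply: eq_rsum => v; rewrite /w /B /C -/cost1 -/cost2; lra.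
  have cost0 v : 0 <= cost1 x v + cost2 x v.
    apply: Rplus_le_le_0_compat; apply: cloud_cost_ge0;
      [exact: (P_nonneg ok1)|exact: (q_nonneg ok1)|exact: i1.1|
       exact: (P_nonneg ok2)|exact: (q_nonneg ok2)|exact: i2.1].
  have rest0 : 0 <= \rsum_v w x v * (B x v o0 o1 + C x v o0 o2).
    rewrite e; apply: Rmult_le_pos; first by apply: Rlt_le; apply: Rdiv_lt_0_compat; lra.
    apply: rsum_ge0 => v; apply: Rmult_le_pos; first exact: (q0_pmf ok1 x).1.
    by apply: Rmult_le_pos => //; apply: bR_ge0.
  case thin : (thin_codebook (/ INR F0) (q0 x) (c0 o0)).
    exists (k0 o0 vd0, k1 o1 (vd0, vd1), k2 o2 (vd0, vd2)).
    rewrite /A thin /=.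
    have := decoding_error_le T1 S1 vd1 (P_nonneg ok1) (c0 o0) (k0 o0) (c1 o1) (k1 o1) x
      (k0 o0 vd0) (k1 o1 (vd0, vd1)).
    have := decoding_error_le T2 S2 vd2 (P_nonneg ok2) (c0 o0) (k0 o0) (c2 o2) (k2 o2) x
      (k0 o0 vd0) (k2 o2 (vd0, vd2)).
    by rewrite (P_marg ok1) (P_marg ok2) -/(err1 _ _ _) -/(err2 _ _ _); lra.
  (* One [v0] has to serve both receivers, so it is selected for the sum of their cloud costs; [v1]
     and [v2] can then be selected separately. *)
  have [v0 [cv0 hv0]] := exists_cheap_word (q0_pmf ok1 x).1 cost0 i0.1 (negbT thin).
  have [v1 h1] := select1 x v0 cv0; have [v2 h2] := select2 x v0 cv0.
  exists (k0 o0 v0, k1 o1 (v0, v1), k2 o2 (v0, v2)) => /=.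
  by rewrite e /A thin /=; lra.
pose enc x := sval (constructive_indefinite_description _ (select x)).
exists enc, (decoder S1 vd1 (c0 o0) (k0 o0) (c1 o1) (k1 o1)),
  (decoder S2 vd2 (c0 o0) (k0 o0) (c2 o2) (k2 o2)).
apply: Rle_trans mean_total; rewrite -rsumD; apply: rsum_le => x.
exact: (svalP (constructive_indefinite_description _ (select x))).
Qed.

End OneShot.

(** * Product laws and the weak law of large numbers *)

Lemma rprod_ge0 n (f : 'I_n -> R) : (forall i, 0 <= f i) -> 0 <= \rprod_(i < n) f i.
Proof.
by move=> h; apply: (big_ind (fun x => 0 <= x)) => //; [lra | exact: Rmult_le_pos].
Qed.

Lemma rprod_le1 n (f : 'I_n -> R) : (forall i, 0 <= f i <= 1) -> \rprod_(i < n) f i <= 1.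
Proof.
move=> h; suff : 0 <= \rprod_(i < n) f i <= 1 by case.
apply: (big_ind (fun x => 0 <= x <= 1)) => //; first lra.
by move=> x y ? ?; nra.
Qed.

Lemma rprod_gt0_factor n (f : 'I_n -> R) i :
  (forall i, 0 <= f i) -> 0 < \rprod_(i < n) f i -> 0 < f i.
Proof.
move=> h; rewrite (bigD1 i) //= => hp.
by case: (Rle_lt_or_eq_dec _ _ (h i)) => // e; rewrite -e Rmult_0_l in hp; lra.
Qed.

Section Tuples.
Variable n : nat.

Lemma rsum_tuple_prod (A : finType) (F : 'I_n -> A -> R) :
  (\rsum_(t : n.-tuple A) \rprod_(i < n) F i (tnth t i)) = \rprod_(i < n) rsum (F i).
Proof.
rewrite (@rsum_reindex _ _ (fun o : {ffun 'I_n -> A} => [tuple o i | i < n])).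
  by rewrite rprod_rsum_ffun; apply: eq_rsum => o; apply: eq_bigr => i _; rewrite tnth_mktuple.
exists (fun t => [ffun i => tnth t i]) => [o|t].
  by apply/ffunP => i; rewrite ffunE tnth_mktuple.
by apply: eq_from_tnth => i; rewrite tnth_mktuple ffunE.
Qed.

Definition iid_law (A : finType) (Q : A -> R) (t : n.-tuple A) : R :=
  \rprod_(i < n) Q (tnth t i).

Definition prod_kernel (A B : finType) (q : A -> B -> R) (s : n.-tuple A) (t : n.-tuple B) : R :=
  \rprod_(i < n) q (tnth s i) (tnth t i).

Definition prod_kernel2 (A B C : finType) (q : A -> B -> C -> R)
    (s : n.-tuple A) (t : n.-tuple B) (u : n.-tuple C) : R :=
  \rprod_(i < n) q (tnth s i) (tnth t i) (tnth u i).

Lemma iid_law_pmf (A : finType) (Q : A -> R) : is_pmf Q -> is_pmf (iid_law Q).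
Proof.
move=> [Q0 Q1]; split=> [t|]; first by apply: rprod_ge0.
by rewrite (rsum_tuple_prod (fun=> Q)) big1.
Qed.

Lemma receiver_ok_prod (X Y V0 V : finType) (px : X -> R) (q0 : X -> V0 -> R)
    (P : X -> Y -> R) (q : X -> V0 -> V -> R) :
  receiver_ok px q0 P q ->
  receiver_ok (iid_law px) (prod_kernel q0) (prod_kernel P) (prod_kernel2 q).
Proof.
move=> ok; split.
- exact: iid_law_pmf (px_pmf ok).
- move=> xs; split=> [vs|]; first by apply: rprod_ge0 => i; apply: (q0_pmf ok _).1.
  by rewrite (rsum_tuple_prod (fun i => q0 (tnth xs i))) big1 // => i _; apply: (q0_pmf ok _).2.
- by move=> xs ys; apply: rprod_ge0 => i; apply: (P_nonneg ok).
- move=> xs; rewrite (rsum_tuple_prod (fun i => P (tnth xs i))).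
  by apply: eq_bigr => i _; apply: (P_marg ok).
- by move=> xs v0s vs; apply: rprod_ge0 => i; apply: (q_nonneg ok).
(* A positive product forces every single-letter [q0] to be positive, so every row of [q] involved
   is normalised. *)
- move=> xs v0s h; rewrite (rsum_tuple_prod (fun i => q (tnth xs i) (tnth v0s i))).
  rewrite big1 // => i _; apply: (q_cond ok).
  by apply: (rprod_gt0_factor (f := fun i => q0 (tnth xs i) (tnth v0s i))) h => j;
    apply: (q0_pmf ok _).1.
Qed.

Definition unzip4 (X Y V0 V : finType) (t : n.-tuple (X * Y * V0 * V)) :
    n.-tuple X * n.-tuple Y * n.-tuple V0 * n.-tuple V :=
  ([tuple (tnth t i).1.1.1 | i < n], [tuple (tnth t i).1.1.2 | i < n],
   [tuple (tnth t i).1.2 | i < n], [tuple (tnth t i).2 | i < n]).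

Lemma mean_rlaw_prod (X Y V0 V : finType) (q0 : X -> V0 -> R)
    (P : X -> Y -> R) (q : X -> V0 -> V -> R) f :
  mean (rlaw (prod_kernel q0) (prod_kernel P) (prod_kernel2 q)) f =
  mean (iid_law (rlaw q0 P q)) (fun t => f (unzip4 t)).
Proof.
rewrite /mean (@rsum_reindex _ _ (@unzip4 X Y V0 V)).
  apply: eq_rsum => t; congr (_ * _); rewrite /rlaw /= -!big_split /=.
  by apply: eq_bigr => i _; rewrite !tnth_mktuple.
exists (fun s => [tuple (tnth s.1.1.1 i, tnth s.1.1.2 i, tnth s.1.2 i, tnth s.2 i) | i < n]).
  by move=> t; apply: eq_from_tnth => i; rewrite !tnth_mktuple; case: (tnth t i) => [[[]]].
move=> [[[xs ys] v0s] vs]; rewrite /unzip4 /=.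
by congr (_, _, _, _); apply: eq_from_tnth => i; rewrite !tnth_mktuple.
Qed.

End Tuples.

Section LawOfLargeNumbers.
Variables (A : finType) (Q : A -> R).
Hypothesis Q_pmf : is_pmf Q.

(** Products of different coordinates have mean zero by independence and centring, so only the
    diagonal survives. *)
Lemma mean_iid_square n (f : A -> R) : mean Q f = 0 ->
  mean (iid_law Q) (fun t : n.-tuple A => (\big[Rplus/0]_(i < n) f (tnth t i)) *
    (\big[Rplus/0]_(i < n) f (tnth t i))) = INR n * mean Q (fun a => f a * f a).
Proof.
move=> f0.
have fi (i j : 'I_n) : mean (iid_law Q) (fun t => f (tnth t i) * f (tnth t j)) =
    bR (i == j) * mean Q (fun a => f a * f a).
  transitivity (\rsum_(t : n.-tuple A) \rprod_(k < n) (Q (tnth t k) *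
      ((if k == i then f (tnth t k) else 1) * (if k == j then f (tnth t k) else 1)))).
    apply: eq_rsum => t; rewrite !big_split /= (rprod_if i (fun k => f (tnth t k))).
    by rewrite (rprod_if j (fun k => f (tnth t k))).
  rewrite (rsum_tuple_prod (fun k a => Q a * ((if k == i then f a else 1) *
    (if k == j then f a else 1)))).
  case: (eqVneq i j) => [<-|ne] /=.
    rewrite Rmult_1_l -[RHS](rprod_if i (fun=> mean Q (fun a => f a * f a))).
    apply: eq_bigr => k _; case: (k == i) => //.
    by rewrite -[RHS]Q_pmf.2; apply: eq_rsum => a; lra.
  rewrite (bigD1 i) //= eqxx (negbTE ne) Rmult_0_l.
  rewrite (@eq_rsum _ _ (fun a => Q a * f a)); last by move=> a; rewrite Rmult_1_r.
  by rewrite -/(mean Q f) f0 Rmult_0_l.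
transitivity (\rsum_(i : 'I_n) \rsum_(j : 'I_n) bR (j == i) * mean Q (fun a => f a * f a)).
  rewrite (@eq_mean _ _ _ (fun t => \rsum_(i : 'I_n) \rsum_(j : 'I_n)
    (f (tnth t i) * f (tnth t j)))).
    rewrite mean_rsum //; apply: eq_rsum => i; rewrite mean_rsum //; apply: eq_rsum => j.
    by rewrite fi eq_sym.
  move=> t; rewrite -/(rsum (fun i => f (tnth t i))) rsumMr; apply: eq_rsum => i.
  by rewrite rsumMl.
by rewrite (eq_rsum (fun i => rsum_eq1 (fun=> mean Q (fun a => f a * f a)) i)) rsum_const card_ord.
Qed.

Lemma weak_law (f : A -> R) (d : R) : 0 < d -> exists C, forall n, (0 < n)%N ->
  mean (iid_law Q) (fun t : n.-tuple A =>
    bR (~~ Rleb (Rabs ((\big[Rplus/0]_(i < n) f (tnth t i)) - INR n * mean Q f)) (INR n * d)))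
  <= C / INR n.
Proof.
move=> d0; pose g a := f a - mean Q f.
have g0 : mean Q g = 0.
  rewrite /g (@eq_mean _ _ _ (fun a => f a + (- mean Q f))) //.
  by rewrite meanD mean_const //; lra.
exists (mean Q (fun a => g a * g a) / (d * d)) => n n0.
have n0' : 0 < INR n by apply/lt_0_INR/ltP.
have sg (t : n.-tuple A) : (\big[Rplus/0]_(i < n) f (tnth t i)) - INR n * mean Q f =
    \big[Rplus/0]_(i < n) g (tnth t i).
  have := rsumB (fun i : 'I_n => f (tnth t i)) (fun=> mean Q f).
  by rewrite rsum_const card_ord => <-.
apply: (Rle_trans _ (mean (iid_law Q) (fun t : n.-tuple A => / (INR n * d * (INR n * d)) *
    ((\big[Rplus/0]_(i < n) g (tnth t i)) * \big[Rplus/0]_(i < n) g (tnth t i))))).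
  apply: mean_le; first exact: iid_law_pmf.
  move=> t; rewrite sg; set s := \big[_/_]_(i < n) _.
  have nd : 0 < INR n * d by nra.
  case: RlebP => /= [_|/Rnot_le_lt h].
    apply: Rmult_le_pos; last by have := Rle_0_sqr s; rewrite /Rsqr.
    by apply: Rlt_le; apply: Rinv_0_lt_compat; nra.
  apply: (Rmult_le_reg_l (INR n * d * (INR n * d))); first nra.
  have -> : INR n * d * (INR n * d) * (/ (INR n * d * (INR n * d)) * (s * s)) = s * s.
    by field; lra.
  by have := Rabs_pos s; have : Rabs s * Rabs s = s * s;
    [rewrite -Rabs_mult Rabs_pos_eq //; nra | nra].
rewrite meanMl mean_iid_square //; apply: Req_le; field; lra.
Qed.

End LawOfLargeNumbers.

(** An explicit bound rather than a limit: finitely many error terms add up to one constant, fixed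
    before the codes are chosen for each [n]. Chebyshev's inequality supplies exactly this order,
    and the exponential terms are smaller. *)
Definition Oinv (f : nat -> R) : Prop :=
  exists C, forall n, (0 < n)%N -> f n <= C / INR n.

Lemma Oinv_le f g : (forall n, (0 < n)%N -> f n <= g n) -> Oinv g -> Oinv f.
Proof. by move=> fg [C h]; exists C => n n0; apply: Rle_trans (fg n n0) (h n n0). Qed.

Lemma OinvD f g : Oinv f -> Oinv g -> Oinv (fun n => f n + g n).
Proof.
move=> [C h] [D k]; exists (C + D) => n n0; rewrite Rdiv_plus_distr.
by apply: Rplus_le_compat; auto.
Qed.

Lemma OinvM c f : 0 <= c -> Oinv f -> Oinv (fun n => c * f n).
Proof.
move=> c0 [C h]; exists (c * C) => n n0; rewrite /Rdiv Rmult_assoc.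
by apply: Rmult_le_compat_l => //; apply: h.
Qed.

Lemma Oinv0 : Oinv (fun=> 0).
Proof. by exists 0 => n _; rewrite /Rdiv Rmult_0_l; lra. Qed.

Lemma Oinv_rsum (A : finType) (f : A -> nat -> R) :
  (forall a, Oinv (f a)) -> Oinv (fun n => \rsum_a f a n).
Proof.
move=> h; rewrite /rsum; elim: (index_enum A) => [|a s ih].
  by apply: Oinv_le Oinv0 => n _; rewrite big_nil; lra.
by apply: Oinv_le (OinvD (h a) ih) => n _; rewrite big_cons; lra.
Qed.

Lemma ln2_gt0 : 0 < ln 2. Proof. by have := ln_lt_2; lra. Qed.

Lemma Rpower2_gt0 x : 0 < Rpower 2 x. Proof. exact: exp_pos. Qed.

Lemma Rpower2_le x y : x <= y -> Rpower 2 x <= Rpower 2 y.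
Proof. by move=> h; apply: Rle_Rpower => //; lra. Qed.

Lemma Oinv_Rpower2 a : 0 < a -> Oinv (fun n => Rpower 2 (INR n * - a)).
Proof.
move=> a0; exists (/ (a * ln 2)) => n n0; have l0 := ln2_gt0.
have n0' : 0 < INR n by apply/lt_0_INR/ltP.
have y0 : 0 < INR n * (a * ln 2) by do ![apply: Rmult_lt_0_compat => //].
rewrite /Rpower (_ : INR n * - a * ln 2 = - (INR n * (a * ln 2))); last by lra.
rewrite exp_Ropp (_ : / (a * ln 2) / INR n = / (INR n * (a * ln 2))); last first.
  by field; lra.
apply: Rinv_le_contravar => //; have := exp_ineq1_le (INR n * (a * ln 2)); lra.
Qed.

Lemma Rpower2_log2 a : 0 < a -> Rpower 2 (log2 a) = a.
Proof.
move=> a0; have l0 := ln2_gt0.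
by rewrite /Rpower /log2 (_ : ln a / ln 2 * ln 2 = ln a) ?exp_ln //; field; lra.
Qed.

Lemma rprod_log2 n (f : 'I_n -> R) : (forall i, 0 < f i) ->
  \rprod_(i < n) f i = Rpower 2 (\big[Rplus/0]_(i < n) log2 (f i)).
Proof.
move=> h; elim/big_ind2: _ => [|x a y b -> ->|i _].
- by rewrite Rpower_O //; lra.
- by rewrite Rpower_plus.
- by rewrite Rpower2_log2.
Qed.

Section MessageSize.
Variables (n : nat) (r : R).
Hypothesis r_ge0 : 0 <= r.

(** A nonnegative rate makes the real size at least 1, so rounding down loses at most a factor 2. *)
Lemma msize_bounds :
  1 <= INR (msize n r) <= Rpower 2 (INR n * r) /\ Rpower 2 (INR n * r) <= 2 * INR (msize n r).
Proof.
set x := Rpower 2 _.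
have x1 : 1 <= x.
  rewrite -(Rpower_O 2); last lra.
  by apply: Rpower2_le; apply: Rmult_le_pos => //; apply: pos_INR.
have [h1 h2] := base_Int_part x; rewrite /msize -/x.
have z0 : (0 < Int_part x)%Z by apply: lt_IZR; lra.
have -> : INR (Z.to_nat (Int_part x)) = IZR (Int_part x) by rewrite INR_IZR_INZ Z2Nat.id //; lia.
have z1 : 1 <= IZR (Int_part x) by apply: IZR_le; lia.
by lra.
Qed.

Lemma msize_gt0 : (0 < msize n r)%N.
Proof.
by have [[h _] _] := msize_bounds; apply/ltP; apply: INR_lt; rewrite /=; lra.
Qed.

(** The slack [s <= r] absorbs the truncation at 0 of codebook rates of the form [Rmax 0 s]. *)
Lemma inv_msize_le s : s <= r -> / INR (msize n r) <= 2 * Rpower 2 (INR n * - s).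
Proof.
move=> sr; have [[h1 h2] h3] := msize_bounds.
apply: (Rle_trans _ (2 * / Rpower 2 (INR n * r))).
  have x0 := Rpower2_gt0 (INR n * r).
  rewrite -[X in _ <= X]Rinv_inv Rinv_mult Rinv_inv.
  by apply: Rinv_le_contravar; lra.
apply: Rmult_le_compat_l; first lra.
rewrite -Rpower_Ropp; apply: Rpower2_le; have := pos_INR n; nra.
Qed.

End MessageSize.

(* If [mu + 2 d >= 0] then [msize] is 1: the codebook keeps every word. *)
Lemma msize_tau n mu d :
  (INR (msize n (Rmax 0 (- mu - 2 * d))) - 1) * Rpower 2 (INR n * (mu + d)) <=
  Rpower 2 (INR n * - d).
Proof.
have [[h1 h2] _] := msize_bounds n (Rmax_l 0 (- mu - 2 * d)).
have p1 := Rpower2_gt0 (INR n * (mu + d)); have p2 := Rpower2_gt0 (INR n * - d).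
move: h1 h2; rewrite /Rmax; case: Rle_dec => h h1 h2; last first.
  by rewrite Rmult_0_r Rpower_O in h2; [nra | lra].
apply: (Rle_trans _ (Rpower 2 (INR n * (- mu - 2 * d)) * Rpower 2 (INR n * (mu + d)))).
  by apply: Rmult_le_compat_r; lra.
rewrite -Rpower_plus; apply: Req_le; congr Rpower; lra.
Qed.

(** * Asymptotic equipartition and typicality *)

Section Equipartition.
Variables (A : finType) (Q : A -> R).
Hypothesis Q_pmf : is_pmf Q.

Lemma mean_le_supp (O : finType) (rho f g : O -> R) : (forall o, 0 <= rho o) ->
  (forall o, 0 < rho o -> f o <= g o) -> mean rho f <= mean rho g.
Proof.
move=> r0 h; apply: rsum_le => o.
case: (Rle_lt_or_eq_dec _ _ (r0 o)) => [ro|<-]; last by lra.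
by apply: Rmult_le_compat_l; [lra | apply: h].
Qed.

Lemma iid_law_supp n (t : n.-tuple A) i : 0 < iid_law Q t -> 0 < Q (tnth t i).
Proof. by apply: (rprod_gt0_factor (f := fun i => Q (tnth t i))) => j; apply: Q_pmf.1. Qed.

Variables (phi : A -> R) (d : R).
Hypotheses (phi_gt0 : forall a, 0 < Q a -> 0 < phi a) (d_gt0 : 0 < d).
Let mu := mean Q (fun a => log2 (phi a)).

(** The function [phi] need not be a mass function of [Q], only positive on its support, so that
    transition kernels are covered. Off the support [log2] carries no information, but those tuples
    have probability zero. *)
Lemma aep_upper : Oinv (fun n => mean (iid_law Q) (fun t : n.-tuple A =>
  bR (~~ Rleb (\rprod_(i < n) phi (tnth t i)) (Rpower 2 (INR n * (mu + d)))))).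
Proof.
have [C hC] := weak_law Q_pmf (fun a => log2 (phi a)) d_gt0.
exists C => n n0; apply: Rle_trans (hC n n0).
apply: mean_le_supp; first exact: (iid_law_pmf n Q_pmf).1.
move=> t Qt; rewrite rprod_log2; last by move=> i; apply: phi_gt0; apply: iid_law_supp.
case: RlebP => [_|h] /=; first exact: bR_ge0.
case: RlebP => [h'|_] /=; last by lra.
case: h; apply: Rpower2_le; rewrite /= -/mu in h'.
have aux x y z : x - y <= z -> x <= y + z by lra.
rewrite Rmult_plus_distr_l; exact: aux (Rle_trans _ _ _ (Rle_abs _) h').
Qed.

Lemma aep_lower : Oinv (fun n => mean (iid_law Q) (fun t : n.-tuple A =>
  bR (~~ Rleb (Rpower 2 (INR n * (mu - d))) (\rprod_(i < n) phi (tnth t i))))).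
Proof.
have [C hC] := weak_law Q_pmf (fun a => log2 (phi a)) d_gt0.
exists C => n n0; apply: Rle_trans (hC n n0).
apply: mean_le_supp; first exact: (iid_law_pmf n Q_pmf).1.
move=> t Qt; rewrite rprod_log2; last by move=> i; apply: phi_gt0; apply: iid_law_supp.
case: RlebP => [_|h] /=; first exact: bR_ge0.
case: RlebP => [h'|_] /=; last by lra.
case: h; apply: Rpower2_le; rewrite /= -/mu in h'.
move: h'; rewrite -Rabs_Ropp => h'.
have aux x y z : - (x - y) <= z -> y - z <= x by lra.
rewrite Rmult_minus_distr_l; exact: aux (Rle_trans _ _ _ (Rle_abs _) h').
Qed.

End Equipartition.

Section Typicality.
Variables (A B : finType) (Q : A -> R) (g : A -> B) (eps : R).
Hypotheses (Q_pmf : is_pmf Q) (eps_gt0 : 0 < eps).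

Lemma count_mem_sum n (t : n.-tuple A) b :
  INR (count_mem b [seq g a | a <- t]) = \big[Rplus/0]_(i < n) bR (g (tnth t i) == b).
Proof.
rewrite -(big_tuple _ _ t xpredT (fun a => bR (g a == b))) /=.
elim: (tval t) => [|a s ih]; first by rewrite big_nil.
rewrite big_cons -ih /= plus_INR; congr (_ + _).
by case: (g a == b).
Qed.

Lemma mean_atypical : Oinv (fun n => mean (iid_law Q) (fun t : n.-tuple A =>
  bR (~~ typicalb (pushfwd Q g) eps [seq g a | a <- t]))).
Proof.
pose bad (b : B) n := mean (iid_law Q) (fun t : n.-tuple A =>
  bR (~~ Rleb (Rabs (INR (count_mem b [seq g a | a <- t]) / INR n - pushfwd Q g b))
     (eps * pushfwd Q g b))).
apply: (@Oinv_le _ (fun n => \rsum_b bad b n)).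
  move=> n n0; rewrite /bad -mean_rsum; apply: mean_le; first exact: iid_law_pmf.
  move=> t; pose F b := bR (~~ Rleb (Rabs (INR (count_mem b [seq g a | a <- t]) / INR n
    - pushfwd Q g b)) (eps * pushfwd Q g b)).
  rewrite -/(rsum F).
  have F0 b : 0 <= F b by apply: bR_ge0.
  rewrite /typicalb; case: (boolP [forall _, _]) => /= [_|]; first exact: rsum_ge0.
  rewrite negb_forall => /existsP [b nb]; apply: Rle_trans (rsum_ge_term b F0).
  by rewrite size_map size_tuple in nb; rewrite /F nb; apply: Rle_refl.
apply: Oinv_rsum => b; rewrite /bad.
have mb : mean Q (fun a => bR (g a == b)) = pushfwd Q g b.
  by rewrite pushfwdE; apply: eq_rsum => a; lra.
case: (Rle_lt_or_eq_dec _ _ (pushfwd_ge0 Q_pmf.1 g b)) => [pb|pb].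
  have [C hC] := weak_law Q_pmf (fun a => bR (g a == b)) (Rmult_lt_0_compat _ _ eps_gt0 pb).
  exists C => n n0; apply: Rle_trans (hC n n0); apply: mean_le; first exact: iid_law_pmf.
  have n0' : 0 < INR n by apply/lt_0_INR/ltP.
  move=> t; rewrite count_mem_sum mb; set s := \big[_/_]_(i < n) _.
  case: RlebP => [_|h] /=; first exact: bR_ge0.
  case: RlebP => [h'|_] /=; last by lra.
  case: h; apply: (Rmult_le_reg_l (INR n)) => //.
  rewrite -{1}(Rabs_pos_eq (INR n)); last by lra.
  rewrite -Rabs_mult (_ : INR n * _ = s - INR n * pushfwd Q g b) //; field; lra.
(* For a letter of mass zero the relative tolerance is zero: it must not occur at all, and with
   probability one it does not. *)
apply: Oinv_le Oinv0 => n n0.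
rewrite -(mean_const (iid_law_pmf n Q_pmf) 0).
apply: mean_le_supp; first exact: (iid_law_pmf n Q_pmf).1.
move=> t Qt; rewrite count_mem_sum -pb big1.
  by case: RlebP => /= [|[]]; rewrite /Rdiv ?Rmult_0_l ?Rmult_0_r ?Rminus_0_r ?Rabs_R0; lra.
move=> i _; case: eqP => // e.
have := pushfwd_gt0 Q_pmf.1 g (iid_law_supp Q_pmf i Qt).
by rewrite e -pb; lra.
Qed.

End Typicality.

(** * Block coding *)

Lemma bR_Rleb_le c x : 0 < c -> 0 <= x -> bR (Rleb c x) <= x * / c.
Proof.
move=> c0 x0; case: RlebP => /= h.
  by apply: (Rmult_le_reg_r c) => //; rewrite Rmult_assoc Rinv_l; lra.
by apply: Rmult_le_pos => //; apply: Rlt_le; apply: Rinv_0_lt_compat.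
Qed.

(** Here [mu] is minus a conditional entropy. One [d] of the slack pays for the threshold
    [tau = 2^(n (mu + d))], the other makes the Chebyshev term decay like [2^(- n d)]. *)
Definition code_rate (mu d : R) : R := Rmax 0 (- mu - 2 * d).

Section BlockReceiver.
Variables (X Y V0 V : finType).
Variables (px : X -> R) (q0 : X -> V0 -> R) (P : X -> Y -> R) (q : X -> V0 -> V -> R).
Hypothesis ok : receiver_ok px q0 P q.
Let Q := rlaw q0 P q.
Variables (m : V0 -> Y -> V -> R) (m0 : Y -> V0 -> V -> R).
Hypotheses (m_ge0 : forall v0 y v, 0 <= m v0 y v) (m0_ge0 : forall y v0 v, 0 <= m0 y v0 v).
Hypotheses (m_sum : forall v0 y, rsum (m v0 y) <= 1)
  (m0_sum : forall y, (\rsum_v0 rsum (m0 y v0)) <= 1).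
Hypotheses (m_supp : forall z, 0 < Q z -> 0 < m z.1.2 z.1.1.2 z.2)
  (m0_supp : forall z, 0 < Q z -> 0 < m0 z.1.1.2 z.1.2 z.2).
Variables (R0 R1 mu0 d eps : R).
Let muq := mean Q (fun z => log2 (q z.1.1.1 z.1.2 z.2)).
Let mum := mean Q (fun z => log2 (m z.1.2 z.1.1.2 z.2)).
Let mum0 := mean Q (fun z => log2 (m0 z.1.1.2 z.1.2 z.2)).
Hypotheses (R0_ge0 : 0 <= R0) (R1_ge0 : 0 <= R1) (d_gt0 : 0 < d) (eps_gt0 : 0 < eps).
Hypotheses (rate1 : muq - mum + 3 * d < R1) (rate01 : mu0 + muq - mum0 + 5 * d < R0 + R1).

Definition likely n (v0s : n.-tuple V0) (vs : n.-tuple V) (ys : n.-tuple Y) : bool :=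
  Rleb (Rpower 2 (INR n * (mum - d))) (prod_kernel2 m v0s ys vs) &&
  Rleb (Rpower 2 (INR n * (mum0 - d))) (prod_kernel2 m0 ys v0s vs).

(** Each accepted word has weight at least the threshold and all weights sum to at most 1, so the
    inverse threshold bounds their number. *)
Lemma likely_cond n v0s ys :
  (\rsum_vs bR (@likely n v0s vs ys)) <= Rpower 2 (INR n * - (mum - d)).
Proof.
have c0 := Rpower2_gt0 (INR n * (mum - d)).
have k0 vs : 0 <= prod_kernel2 m v0s ys vs by apply: rprod_ge0.
have -> : Rpower 2 (INR n * - (mum - d)) = 1 * / Rpower 2 (INR n * (mum - d)).
  by rewrite -Rpower_Ropp Rmult_1_l; congr Rpower; lra.
apply: (Rle_trans _ ((\rsum_vs prod_kernel2 m v0s ys vs) * / Rpower 2 (INR n * (mum - d)))).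
  rewrite rsumMr; apply: rsum_le => vs; apply: Rle_trans (bR_Rleb_le c0 (k0 vs)).
  rewrite /likely bRM.
  have := bR_ge0 (Rleb (Rpower 2 (INR n * (mum - d))) (prod_kernel2 m v0s ys vs)).
  by set b := bR (Rleb _ (prod_kernel2 m0 _ _ _)); have : b <= 1 by [apply: bR_le1|]; nra.
apply: Rmult_le_compat_r; first by apply: Rlt_le; apply: Rinv_0_lt_compat.
rewrite (rsum_tuple_prod (fun i => m (tnth v0s i) (tnth ys i))).
by apply: rprod_le1 => i; split=> //; apply: rsum_ge0.
Qed.

Lemma likely_joint n ys :
  (\rsum_v0s \rsum_vs bR (@likely n v0s vs ys)) <= Rpower 2 (INR n * - (mum0 - d)).
Proof.
have c0 := Rpower2_gt0 (INR n * (mum0 - d)).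
have k0 v0s vs : 0 <= prod_kernel2 m0 ys v0s vs by apply: rprod_ge0.
have -> : Rpower 2 (INR n * - (mum0 - d)) = 1 * / Rpower 2 (INR n * (mum0 - d)).
  by rewrite -Rpower_Ropp Rmult_1_l; congr Rpower; lra.
apply: (Rle_trans _ ((\rsum_v0s \rsum_vs prod_kernel2 m0 ys v0s vs) *
    / Rpower 2 (INR n * (mum0 - d)))).
  rewrite rsumMr; apply: rsum_le => v0s; rewrite rsumMr; apply: rsum_le => vs.
  apply: Rle_trans (bR_Rleb_le c0 (k0 v0s vs)).
  rewrite /likely bRM.
  have := bR_ge0 (Rleb (Rpower 2 (INR n * (mum0 - d))) (prod_kernel2 m0 ys v0s vs)).
  by set b := bR (Rleb _ (prod_kernel2 m _ _ _)); have : b <= 1 by [apply: bR_le1|]; nra.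
apply: Rmult_le_compat_r; first by apply: Rlt_le; apply: Rinv_0_lt_compat.
rewrite (@eq_rsum _ _ (fun v0s => \rprod_(i < n) rsum (m0 (tnth ys i) (tnth v0s i)))); last first.
  by move=> v0s; rewrite (rsum_tuple_prod (fun i => m0 (tnth ys i) (tnth v0s i))).
rewrite (rsum_tuple_prod (fun i v0 => rsum (m0 (tnth ys i) v0))).
by apply: rprod_le1 => i; split=> //; apply: rsum_ge0 => v0; apply: rsum_ge0.
Qed.

(** The terms of [receiver_bound] vanish for three reasons: the slack in [code_rate] for thin
    codebooks, the rate hypotheses for clashes, and equipartition and typicality for the
    expectation. *)
Lemma Oinv_block_receiver_bound :
  Oinv (fun n => receiver_bound (msize n (code_rate mu0 d)) (msize n R0)
    (@prod_kernel n _ _ q0) (@prod_kernel n _ _ P) (@prod_kernel2 n _ _ _ q)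
    (fun xs vs => typicalb (pushfwd Q (fun z => (z.1.1.1, z.2))) eps (zip xs vs)) (@likely n)
    (msize n (code_rate muq d)) (msize n R1)
    (Rpower 2 (INR n * - (mum - d))) (Rpower 2 (INR n * - (mum0 - d)))
    (Rpower 2 (INR n * (muq + d)))).
Proof.
have Q_pmf : is_pmf Q := rlaw_pmf ok.
apply: OinvD; first apply: OinvD; first apply: OinvM; try lra.
- by apply: Oinv_le (Oinv_Rpower2 d_gt0) => n _; apply: msize_tau.
- apply: OinvM; first lra.
  (* Each codebook layer costs [2 * d] and the decoding threshold [d]: one layer for a clash under
     the true [v0], two for a wrong [v0]. Below, the factors 4 and 16 are the losses of 2 for each
     of two or four rounded sizes. *)
  pose a1 := R1 - (muq - mum) - 3 * d; pose a2 := R0 + R1 - (mu0 + muq - mum0) - 5 * d.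
  have a1_gt0 : 0 < a1 by rewrite /a1; lra.
  have a2_gt0 : 0 < a2 by rewrite /a2; lra.
  have c4 : 0 <= 4 by lra.
  have c16 : 0 <= 16 by lra.
  apply: Oinv_le (OinvD (OinvM c4 (Oinv_Rpower2 a1_gt0)) (OinvM c16 (Oinv_Rpower2 a2_gt0))).
  move=> n _; rewrite /clash_rate.
  have := inv_msize_le n (Rmax_l 0 (- mu0 - 2 * d)) (Rmax_r 0 (- mu0 - 2 * d)).
  have := inv_msize_le n (Rmax_l 0 (- muq - 2 * d)) (Rmax_r 0 (- muq - 2 * d)).
  have := inv_msize_le n R0_ge0 (Rle_refl R0).
  have := inv_msize_le n R1_ge0 (Rle_refl R1).
  have pos r : 0 <= r -> 0 <= / INR (msize n r).
    by move=> r0; apply: Rlt_le; apply: Rinv_0_lt_compat; have [[? _] _] := msize_bounds n r0; lra.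
  have := pos _ R0_ge0; have := pos _ R1_ge0.
  have := pos _ (Rmax_l 0 (- muq - 2 * d)); have := pos _ (Rmax_l 0 (- mu0 - 2 * d)).
  rewrite -/(code_rate mu0 d) -/(code_rate muq d).
  set p0 := / INR (msize n (code_rate mu0 d)); set p := / INR (msize n (code_rate muq d)).
  set k0 := / INR (msize n R0); set k := / INR (msize n R1).
  move=> p0_ge0 p_ge0 k_ge0 k0_ge0 k_le k0_le p_le p0_le.
  have pk_le : p * k <= 4 * Rpower 2 (INR n * (- (- muq - 2 * d) - R1)).
    apply: (Rle_trans _ _ _ (Rmult_le_compat _ _ _ _ p_ge0 k_ge0 p_le k_le)).
    rewrite (_ : INR n * (- (- muq - 2 * d) - R1) =
      INR n * - (- muq - 2 * d) + INR n * - R1); last by lra.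
    by rewrite Rpower_plus; lra.
  have pk0_le : p0 * k0 <= 4 * Rpower 2 (INR n * (- (- mu0 - 2 * d) - R0)).
    apply: (Rle_trans _ _ _ (Rmult_le_compat _ _ _ _ p0_ge0 k0_ge0 p0_le k0_le)).
    rewrite (_ : INR n * (- (- mu0 - 2 * d) - R0) =
      INR n * - (- mu0 - 2 * d) + INR n * - R0); last by lra.
    by rewrite Rpower_plus; lra.
  have pk_ge0 : 0 <= p * k by exact: Rmult_le_pos.
  have pk0_ge0 : 0 <= p0 * k0 by exact: Rmult_le_pos.
  apply: Rplus_le_compat.
    apply: Rle_trans (Rmult_le_compat_r _ _ _ (Rlt_le _ _ (Rpower2_gt0 _)) pk_le) _.
    rewrite Rmult_assoc -Rpower_plus; apply: Rmult_le_compat_l => //; apply: Rpower2_le.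
    by apply: Req_le; rewrite /a1; lra.
  rewrite (_ : p0 * p * k0 * k = p0 * k0 * (p * k)); last by lra.
  have pp_le := Rmult_le_compat _ _ _ _ pk0_ge0 pk_ge0 pk0_le pk_le.
  apply: Rle_trans (Rmult_le_compat_r _ _ _ (Rlt_le _ _ (Rpower2_gt0 _)) pp_le) _.
  set e0 := INR n * _; set e := INR n * _; set e' := INR n * - _.
  rewrite (_ : 4 * Rpower 2 e0 * (4 * Rpower 2 e) * Rpower 2 e' =
    16 * (Rpower 2 e0 * Rpower 2 e * Rpower 2 e')); last by lra.
  rewrite -!Rpower_plus; apply: Rmult_le_compat_l => //; apply: Rpower2_le.
  by apply: Req_le; rewrite /e0 /e /e' /a2; lra.
have c8 : 0 <= 8 by lra.
have c4 : 0 <= 4 by lra.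
have q_supp z : 0 < Q z -> 0 < q z.1.1.1 z.1.2 z.2.
  move=> Qz; case: (Rle_lt_or_eq_dec _ _ (q_nonneg ok z.1.1.1 z.1.2 z.2)) => // e.
  by rewrite /Q /rlaw -e Rmult_0_r in Qz; lra.
pose E1 := OinvM c8 (aep_upper Q_pmf q_supp d_gt0).
pose E2 := OinvM c4 (mean_atypical (fun z : X * Y * V0 * V => (z.1.1.1, z.2)) Q_pmf eps_gt0).
pose E3 := OinvM c4 (OinvD (aep_lower Q_pmf m_supp d_gt0) (aep_lower Q_pmf m0_supp d_gt0)).
apply: Oinv_le (OinvD (OinvD E1 E2) E3) => n n0.
rewrite mean_rlaw_prod -meanD -!meanMl -!meanD; apply: mean_le; first exact: iid_law_pmf.
move=> t /=.
have -> : prod_kernel2 q [tuple (tnth t i).1.1.1 | i < n] [tuple (tnth t i).1.2 | i < n]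
    [tuple (tnth t i).2 | i < n] =
    \rprod_(i < n) q (tnth t i).1.1.1 (tnth t i).1.2 (tnth t i).2.
  by apply: eq_bigr => i _; rewrite !tnth_mktuple.
have -> : zip [tuple (tnth t i).1.1.1 | i < n] [tuple (tnth t i).2 | i < n] =
    [seq (z.1.1.1, z.2) | z <- t].
  rewrite -[in RHS](map_tnth_enum t) -map_comp /=.
  by elim: (enum 'I_n) => //= i s ->.
rewrite -/muq; apply: Rplus_le_compat_l; apply: Rmult_le_compat_l => //.
have -> : likely [tuple (tnth t i).1.2 | i < n] [tuple (tnth t i).2 | i < n]
    [tuple (tnth t i).1.1.2 | i < n] =
  Rleb (Rpower 2 (INR n * (mum - d)))
    (\rprod_(i < n) m (tnth t i).1.2 (tnth t i).1.1.2 (tnth t i).2) &&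
  Rleb (Rpower 2 (INR n * (mum0 - d)))
    (\rprod_(i < n) m0 (tnth t i).1.1.2 (tnth t i).1.2 (tnth t i).2).
  by congr (Rleb _ _ && Rleb _ _); apply: eq_bigr => i _; rewrite !tnth_mktuple.
rewrite -/mum -/mum0.
by case: (Rleb _ (\big[_/_]_(i < n) m _ _ _)); case: (Rleb _ _) => /=; lra.
Qed.

End BlockReceiver.

(** * Conditional mutual informations as mean log-likelihood ratios *)

Lemma pushfwd_comp (O A B : finType) (Q : O -> R) (f : O -> A) (g : A -> B) b :
  pushfwd (pushfwd Q f) g b = pushfwd Q (fun w => g (f w)) b.
Proof.
rewrite pushfwdE (@eq_rsum _ _ (fun a => pushfwd Q f a * bR (g a == b)));
  last by move=> a; rewrite Rmult_comm.
by rewrite (rsum_pushfwd _ _ (fun a => bR (g a == b))) pushfwdE; apply: eq_rsum => w; lra.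
Qed.

Lemma ent_pushfwd (O A B : finType) (Q : O -> R) (L : A -> R) (f : O -> A) (g : A -> B) :
  (forall a, L a = pushfwd Q f a) -> ent Q (fun w => g (f w)) = ent L g.
Proof.
move=> h; rewrite /ent /entropy; congr (- _).
have e b : pushfwd L g b = pushfwd Q (fun w => g (f w)) b.
  by rewrite -[RHS]pushfwd_comp (pushfwdE L) (pushfwdE (pushfwd Q f));
    apply: eq_rsum => a; rewrite h.
by apply: eq_rsum => b; rewrite !e.
Qed.

Lemma rsum_pushfwd_fst (O A B : finType) (Q : O -> R) (f : O -> A) (g : O -> B) b :
  (\rsum_a pushfwd Q (fun w => (f w, g w)) (a, b)) = pushfwd Q g b.
Proof.
rewrite (@eq_rsum _ _ (fun a => \rsum_w bR (a == f w) * (bR (g w == b) * Q w))).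
  rewrite rsum_exchange pushfwdE; apply: eq_rsum => w.
  by rewrite (rsum_eq1 (fun=> bR (g w == b) * Q w)).
by move=> a; rewrite pushfwdE; apply: eq_rsum => w; rewrite xpair_eqE bRM (eq_sym a); lra.
Qed.

Lemma Rdiv_self_le1 x : x * / x <= 1.
Proof. by case: (Req_dec x 0) => [->|h]; [rewrite Rmult_0_l; lra | rewrite Rinv_r; lra]. Qed.

Lemma log2_div a b : 0 < a -> 0 < b -> log2 (a * / b) = log2 a - log2 b.
Proof.
move=> a0 b0; rewrite log2M //; last exact: Rinv_0_lt_compat.
by rewrite /log2 ln_Rinv //; lra.
Qed.

Section Projections.
Variables X Y V0 V : finType.
Definition zX (z : X * Y * V0 * V) := z.1.1.1.
Definition zY (z : X * Y * V0 * V) := z.1.1.2.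
Definition zV0 (z : X * Y * V0 * V) := z.1.2.
Definition zV (z : X * Y * V0 * V) := z.2.
End Projections.
Arguments zX {X Y V0 V} z.
Arguments zY {X Y V0 V} z.
Arguments zV0 {X Y V0 V} z.
Arguments zV {X Y V0 V} z.

Section SingleLetter.
Variables (X Y V0 V : finType).
Variables (px : X -> R) (q0 : X -> V0 -> R) (P : X -> Y -> R) (q : X -> V0 -> V -> R).
Hypothesis ok : receiver_ok px q0 P q.
Let L := rlaw q0 P q.
Let L_pmf : is_pmf L := rlaw_pmf ok.
Let L_ge0 := L_pmf.1.

(* Division by zero gives 0, so these are sub-probabilities in [v] and in [(v0, v)]. *)
Definition cond_metric (v0 : V0) (y : Y) (v : V) : R :=
  pushfwd L (fun z => (zV z, (zV0 z, zY z))) (v, (v0, y)) *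
  / pushfwd L (fun z => (zV0 z, zY z)) (v0, y).

Definition joint_metric (y : Y) (v0 : V0) (v : V) : R :=
  pushfwd L (fun z => (zV0 z, zV z, zY z)) (v0, v, y) * / pushfwd L zY y.

Lemma pushfwd_quot_ge0 (A B : finType) (f : _ -> A) (g : _ -> B) a b :
  0 <= pushfwd L f a * / pushfwd L g b.
Proof.
apply: Rmult_le_pos; first exact: pushfwd_ge0.
case: (Rle_lt_or_eq_dec _ _ (pushfwd_ge0 L_ge0 g b)) => [h|<-]; last by rewrite Rinv_0; lra.
by apply: Rlt_le; apply: Rinv_0_lt_compat.
Qed.

Lemma cond_metric_ge0 v0 y v : 0 <= cond_metric v0 y v.
Proof. exact: pushfwd_quot_ge0. Qed.

Lemma joint_metric_ge0 y v0 v : 0 <= joint_metric y v0 v.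
Proof. exact: pushfwd_quot_ge0. Qed.

Lemma cond_metric_sum v0 y : rsum (cond_metric v0 y) <= 1.
Proof.
rewrite /cond_metric -rsumMr (rsum_pushfwd_fst _ _ (fun z => (zV0 z, zY z))).
exact: Rdiv_self_le1.
Qed.

Lemma joint_metric_sum y : (\rsum_v0 rsum (joint_metric y v0)) <= 1.
Proof.
rewrite -(rsum_pair (fun u => joint_metric y u.1 u.2)) /joint_metric.
rewrite -(rsumMr _ (fun u => pushfwd L (fun z => (zV0 z, zV z, zY z)) (u.1, u.2, y))).
rewrite (@eq_rsum _ _ (fun u => pushfwd L (fun z => ((zV0 z, zV z), zY z)) (u, y)));
  last by case.
by rewrite (rsum_pushfwd_fst _ (fun z => (zV0 z, zV z)) zY); apply: Rdiv_self_le1.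
Qed.

Lemma pushfwd_XY x y : pushfwd L (fun z => (zX z, zY z)) (x, y) = P x y.
Proof.
rewrite pushfwdE (@eq_rsum _ _ (fun z => L z * (bR (zX z == x) * bR (zY z == y))));
  last by move=> z; rewrite xpair_eqE bRM; lra.
rewrite -/(mean L _) mean_rlaw.
rewrite (@eq_rsum _ _ (fun x' => bR (x' == x) * (P x' y * \rsum_v0 q0 x' v0 * rsum (q x' v0)))).
  rewrite rsum_eq1 (@eq_rsum _ _ (q0 x)); first by rewrite (q0_pmf ok x).2; lra.
  move=> v0 /=; case: (Rle_lt_or_eq_dec _ _ ((q0_pmf ok x).1 v0)) => [h|<-]; last by lra.
  by rewrite (q_cond ok h); lra.
move=> x' /=; rewrite !rsumMl; apply: eq_rsum => v0; rewrite !rsumMl; apply: eq_rsum => v.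
rewrite (@eq_rsum _ _ (fun y' => bR (y' == y) * (bR (x' == x) * P x' y')));
  last by move=> y' /=; rewrite /zX /zY /=; lra.
by rewrite rsum_eq1; lra.
Qed.

Lemma pushfwd_XV0Y x v0 y :
  pushfwd L (fun z => (zX z, (zV0 z, zY z))) (x, (v0, y)) = P x y * q0 x v0.
Proof.
rewrite pushfwdE (@eq_rsum _ _ (fun z => L z * (bR (zX z == x) * (bR (zV0 z == v0) *
  bR (zY z == y))))); last by move=> z; rewrite !xpair_eqE !bRM; lra.
rewrite -/(mean L _) mean_rlaw.
rewrite (@eq_rsum _ _ (fun x' => bR (x' == x) * (P x' y * (q0 x' v0 * rsum (q x' v0))))).
  rewrite rsum_eq1; congr (_ * _).
  case: (Rle_lt_or_eq_dec _ _ ((q0_pmf ok x).1 v0)) => [h|<-]; last by lra.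
  by rewrite (q_cond ok h); lra.
move=> x' /=; rewrite -(rsum_eq1 (fun v0 => q0 x' v0 * rsum (q x' v0))) !rsumMl.
apply: eq_rsum => v0'; rewrite !rsumMl; apply: eq_rsum => v.
rewrite (@eq_rsum _ _ (fun y' => bR (y' == y) * (bR (x' == x) * bR (v0' == v0) * P x' y')));
  last by move=> y' /=; rewrite /zX /zY /zV0 /=; lra.
by rewrite rsum_eq1; lra.
Qed.

Let muq0 := mean L (fun z => log2 (q0 (zX z) (zV0 z))).
Let muq := mean L (fun z => log2 (q (zX z) (zV0 z) (zV z))).
Let mum := mean L (fun z => log2 (cond_metric (zV0 z) (zY z) (zV z))).
Let mum0 := mean L (fun z => log2 (joint_metric (zY z) (zV0 z) (zV z))).

Lemma rlaw_supp z : 0 < L z ->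
  [/\ 0 < P (zX z) (zY z), 0 < q0 (zX z) (zV0 z) & 0 < q (zX z) (zV0 z) (zV z)].
Proof.
rewrite /L /rlaw -/(zX z) -/(zY z) -/(zV0 z) -/(zV z).
have a := P_nonneg ok (zX z) (zY z); have b := (q0_pmf ok (zX z)).1 (zV0 z).
have c := q_nonneg ok (zX z) (zV0 z) (zV z) => h.
split.
- by case: (Rle_lt_or_eq_dec _ _ a) => // e; rewrite -e !Rmult_0_l in h; lra.
- by case: (Rle_lt_or_eq_dec _ _ b) => // e; rewrite -e Rmult_0_r Rmult_0_l in h; lra.
- by case: (Rle_lt_or_eq_dec _ _ c) => // e; rewrite -e Rmult_0_r in h; lra.
Qed.

Lemma cond_metric_supp z : 0 < L z -> 0 < cond_metric (zV0 z) (zY z) (zV z).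
Proof.
move=> Lz; apply: Rmult_lt_0_compat.
  exact: (pushfwd_gt0 L_ge0 (fun z => (zV z, (zV0 z, zY z))) Lz).
apply: Rinv_0_lt_compat; exact: (pushfwd_gt0 L_ge0 (fun z => (zV0 z, zY z)) Lz).
Qed.

Lemma joint_metric_supp z : 0 < L z -> 0 < joint_metric (zY z) (zV0 z) (zV z).
Proof.
move=> Lz; apply: Rmult_lt_0_compat.
  exact: (pushfwd_gt0 L_ge0 (fun z => (zV0 z, zV z, zY z)) Lz).
apply: Rinv_0_lt_compat; exact: (pushfwd_gt0 L_ge0 zY Lz).
Qed.

Lemma mean_eq_supp f g : (forall z, 0 < L z -> f z = g z) -> mean L f = mean L g.
Proof.
by move=> h; apply: Rle_antisym; apply: mean_le_supp => // z Lz; apply: Req_le; rewrite h.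
Qed.

Lemma ent_mean (A : finType) (f : _ -> A) :
  ent L f = - mean L (fun z => log2 (pushfwd L f (f z))).
Proof. exact: ent_mean_log. Qed.

Lemma pushfwd_full (A : finType) (f : X * Y * V0 * V -> A) z :
  injective f -> pushfwd L f (f z) = L z.
Proof.
move=> inj; rewrite pushfwdE -(rsum_eq1 L z); apply: eq_rsum => z'.
by rewrite (inj_eq inj).
Qed.

(** Under [L] the law of [v] given [(x, v0, y)] is [q x v0], by the Markov structure of [rlaw]. The
    information is thus the mean log-ratio of [q] to the decoder's [cond_metric]. *)
Lemma cmi_cond_mean : cmi L zX zV (fun z => (zV0 z, zY z)) = muq - mum.
Proof.
rewrite /cmi /= !ent_mean.
have aux a b c d m u : m = b - d -> c = a + u -> - a + - b - - c - - d = u - m by lra.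
have em : mum = mean L (fun z => log2 (pushfwd L (fun z => (zV z, (zV0 z, zY z)))
      (zV z, (zV0 z, zY z)))) -
    mean L (fun z => log2 (pushfwd L (fun z => (zV0 z, zY z)) (zV0 z, zY z))).
  rewrite -rsumB; transitivity (mean L (fun z => log2 (pushfwd L (fun z => (zV z, (zV0 z, zY z)))
      (zV z, (zV0 z, zY z))) - log2 (pushfwd L (fun z => (zV0 z, zY z)) (zV0 z, zY z))));
    last by apply: eq_rsum => z; lra.
  apply: mean_eq_supp => z Lz; apply: log2_div.
    exact: (pushfwd_gt0 L_ge0 (fun z => (zV z, (zV0 z, zY z))) Lz).
  exact: (pushfwd_gt0 L_ge0 (fun z => (zV0 z, zY z)) Lz).
have ef : mean L (fun z => log2 (pushfwd L (fun z => (zX z, zV z, (zV0 z, zY z)))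
      (zX z, zV z, (zV0 z, zY z)))) =
    mean L (fun z => log2 (pushfwd L (fun z => (zX z, (zV0 z, zY z)))
      (zX z, (zV0 z, zY z)))) + muq.
  rewrite -meanD; apply: mean_eq_supp => z Lz.
  rewrite (@pushfwd_full _ (fun z => (zX z, zV z, (zV0 z, zY z)))); last first.
    by move=> [[[? ?] ?] ?] [[[? ?] ?] ?]; rewrite /zX /zY /zV0 /zV /= => -[-> -> -> ->].
  have [h1 h2 h3] := rlaw_supp Lz.
  by rewrite pushfwd_XV0Y /L /rlaw log2M //; apply: Rmult_lt_0_compat.
exact: (aux _ _ _ _ _ _ em ef).
Qed.

(** The same argument: given [(x, y)] the pair [(v0, v)] has law [q0 x v0 * q x v0 v], whose
    logarithm splits into the costs of the two codebook layers. *)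
Lemma cmi_joint_mean : cmi L zX (fun z => (zV0 z, zV z)) zY = muq0 + muq - mum0.
Proof.
rewrite /cmi /= !ent_mean.
have aux a b c d m u : m = b - d -> c = a + u -> - a + - b - - c - - d = u - m by lra.
have em : mum0 = mean L (fun z => log2 (pushfwd L (fun z => (zV0 z, zV z, zY z))
      (zV0 z, zV z, zY z))) - mean L (fun z => log2 (pushfwd L zY (zY z))).
  rewrite -rsumB; transitivity (mean L (fun z => log2 (pushfwd L (fun z => (zV0 z, zV z, zY z))
      (zV0 z, zV z, zY z)) - log2 (pushfwd L zY (zY z))));
    last by apply: eq_rsum => z; lra.
  apply: mean_eq_supp => z Lz; apply: log2_div.
    exact: (pushfwd_gt0 L_ge0 (fun z => (zV0 z, zV z, zY z)) Lz).
  exact: (pushfwd_gt0 L_ge0 zY Lz).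
have ef : mean L (fun z => log2 (pushfwd L (fun z => (zX z, (zV0 z, zV z), zY z))
      (zX z, (zV0 z, zV z), zY z))) =
    mean L (fun z => log2 (pushfwd L (fun z => (zX z, zY z)) (zX z, zY z))) + (muq0 + muq).
  rewrite -!meanD; apply: mean_eq_supp => z Lz.
  rewrite (@pushfwd_full _ (fun z => (zX z, (zV0 z, zV z), zY z))); last first.
    by move=> [[[? ?] ?] ?] [[[? ?] ?] ?]; rewrite /zX /zY /zV0 /zV /= => -[-> -> -> ->].
  have [h1 h2 h3] := rlaw_supp Lz.
  by rewrite pushfwd_XY /L /rlaw Rmult_assoc !log2M //; apply: Rmult_lt_0_compat.
exact: (aux _ _ _ _ _ _ em ef).
Qed.

End SingleLetter.

Lemma Oinv_Un_cv f : (forall n, 0 <= f n) -> Oinv f -> Un_cv f 0.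
Proof.
move=> f0 [C hC] e e0.
have C0 : 0 < Rabs C + 1 by have := Rabs_pos C; lra.
have [N [hN N0]] := archimed_cor1 (e / (Rabs C + 1)) (Rdiv_lt_0_compat _ _ e0 C0).
exists N => n nN; rewrite /Rdist Rminus_0_r Rabs_pos_eq //.
have n0 : (0 < n)%N by apply/ltP; lia.
apply: Rle_lt_trans (hC n n0) _.
have N0' : 0 < INR N by exact: lt_0_INR.
have n0' : 0 < INR n by apply/lt_0_INR/ltP.
have nN' : / INR n <= / INR N by apply: Rinv_le_contravar => //; apply: le_INR.
apply: (Rle_lt_trans _ ((Rabs C + 1) * / INR N)).
  apply: (Rle_trans _ ((Rabs C + 1) * / INR n)).
    apply: Rmult_le_compat_r; first by apply: Rlt_le; apply: Rinv_0_lt_compat.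
    by have := Rle_abs C; lra.
  by apply: Rmult_le_compat_l => //; lra.
have := Rmult_lt_compat_l _ _ _ C0 hN.
by rewrite (_ : (Rabs C + 1) * (e / (Rabs C + 1)) = e) //; field; lra.
Qed.

Lemma pmf_inhabited (A : finType) (p : A -> R) : is_pmf p -> exists a : A, True.
Proof.
move=> [_ p1]; apply: NNPP => h; suff : rsum p = 0 by lra.
by rewrite -(rsum0 A); apply: eq_rsum => a; case: h; exists a.
Qed.

Lemma eq_typicalb (A : finType) (p p' : A -> R) eps s :
  (forall a, p a = p' a) -> typicalb p eps s = typicalb p' eps s.
Proof. by move=> h; apply: eq_forallb => a; rewrite h. Qed.

(** * Block codes from single-letter rate conditions *)

Section BlockCoding.
Variables (X V0 Y1 V1 Y2 V2 : finType) (px : X -> R) (q0 : X -> V0 -> R).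
Variables (P1 : X -> Y1 -> R) (q1 : X -> V0 -> V1 -> R).
Variables (P2 : X -> Y2 -> R) (q2 : X -> V0 -> V2 -> R).
Hypotheses (ok1 : receiver_ok px q0 P1 q1) (ok2 : receiver_ok px q0 P2 q2).
Let L1 := rlaw q0 P1 q1.
Let L2 := rlaw q0 P2 q2.
Variables (R0 R1 R2 eps : R) (vd0 : V0) (vd1 : V1) (vd2 : V2).
Hypotheses (R0_ge0 : 0 <= R0) (R1_ge0 : 0 <= R1) (R2_ge0 : 0 <= R2) (eps_gt0 : 0 < eps).
Hypotheses (rate1 : cmi L1 zX zV (fun z => (zV0 z, zY z)) < R1)
  (rate2 : cmi L2 zX zV (fun z => (zV0 z, zY z)) < R2)
  (rate01 : cmi L1 zX (fun z => (zV0 z, zV z)) zY < R0 + R1)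
  (rate02 : cmi L2 zX (fun z => (zV0 z, zV z)) zY < R0 + R2).

Definition atypical_prob n (Y V : finType) (P : X -> Y -> R) (L : X * Y * V0 * V -> R)
    (out : n.-tuple X -> n.-tuple Y -> n.-tuple V) : R :=
  \rsum_xs \rsum_ys prod_kernel P xs ys *
    bR (~~ typicalb (pushfwd L (fun z => (z.1.1.1, z.2))) eps (zip xs (out xs ys))).

Lemma block_coding : exists C, forall n, (0 < n)%N ->
  exists (enc : n.-tuple X -> 'I_(msize n R0) * 'I_(msize n R1) * 'I_(msize n R2))
    (dec1 : 'I_(msize n R0) -> 'I_(msize n R1) -> n.-tuple Y1 -> n.-tuple V1)
    (dec2 : 'I_(msize n R0) -> 'I_(msize n R2) -> n.-tuple Y2 -> n.-tuple V2),
  atypical_prob P1 L1 (fun xs => dec1 (enc xs).1.1 (enc xs).1.2) +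
  atypical_prob P2 L2 (fun xs => dec2 (enc xs).1.1 (enc xs).2) <= C / INR n.
Proof.
pose mu0 := mean L1 (fun z => log2 (q0 (zX z) (zV0 z))).
(* Both receiver laws have the same marginal on [(X, V0)], so a single density of the codebook of
   words [v0] suits both. *)
have mu02 : mean L2 (fun z => log2 (q0 (zX z) (zV0 z))) = mu0.
  rewrite /mu0 (mean_rlaw_cloud ok1 (fun x v0 => log2 (q0 x v0))).
  by rewrite (mean_rlaw_cloud ok2 (fun x v0 => log2 (q0 x v0))).
move: rate1 rate2 rate01 rate02.
rewrite (cmi_cond_mean ok1) (cmi_cond_mean ok2) (cmi_joint_mean ok1) (cmi_joint_mean ok2).
rewrite -/L1 -/L2 -/mu0 mu02.
pose muq1 := mean L1 (fun z => log2 (q1 (zX z) (zV0 z) (zV z))).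
pose muq2 := mean L2 (fun z => log2 (q2 (zX z) (zV0 z) (zV z))).
pose mum1 := mean L1 (fun z => log2 (cond_metric q0 P1 q1 (zV0 z) (zY z) (zV z))).
pose mum2 := mean L2 (fun z => log2 (cond_metric q0 P2 q2 (zV0 z) (zY z) (zV z))).
pose mum01 := mean L1 (fun z => log2 (joint_metric q0 P1 q1 (zY z) (zV0 z) (zV z))).
pose mum02 := mean L2 (fun z => log2 (joint_metric q0 P2 q2 (zY z) (zV0 z) (zV z))).
rewrite -/muq1 -/muq2 -/mum1 -/mum2 -/mum01 -/mum02 => r1 r2 r01 r02.
have [d [d_gt0 [d1 [d2 [d01 d02]]]]] : exists d, 0 < d /\ muq1 - mum1 + 3 * d < R1 /\
    muq2 - mum2 + 3 * d < R2 /\ mu0 + muq1 - mum01 + 5 * d < R0 + R1 /\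
    mu0 + muq2 - mum02 + 5 * d < R0 + R2.
  have gap x y : x < y -> exists2 a, 0 < a & y = x + a by exists (y - x); lra.
  have [[a a0 ea] [b b0 eb]] := (gap _ _ r1, gap _ _ r2).
  have [[c c0 ec] [e e0 ee]] := (gap _ _ r01, gap _ _ r02).
  have ma := Rmin_l a b; have mb := Rmin_r a b; have mc := Rmin_l c e; have me := Rmin_r c e.
  have m1 := Rmin_l (Rmin a b) (Rmin c e); have m2 := Rmin_r (Rmin a b) (Rmin c e).
  have m0 : 0 < Rmin (Rmin a b) (Rmin c e) by do ![apply: Rmin_glb_lt].
  (* Any divisor above 5 keeps all four inequalities strict, since the largest loss is [5 * d]. *)
  by exists (Rmin (Rmin a b) (Rmin c e) / 6); lra.
have [C1 b1] := Oinv_block_receiver_bound ok1 (cond_metric_supp ok1) (joint_metric_supp ok1)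
  R0_ge0 R1_ge0 d_gt0 eps_gt0 d1 d01.
have [C2 b2] := Oinv_block_receiver_bound ok2 (cond_metric_supp ok2) (joint_metric_supp ok2)
  R0_ge0 R2_ge0 d_gt0 eps_gt0 d2 d02.
have q0_supp z : 0 < L1 z -> 0 < q0 (zX z) (zV0 z) by case/(rlaw_supp ok1).
have [C3 b3] := aep_upper (rlaw_pmf ok1) q0_supp d_gt0.
have [C4 b4] := Oinv_Rpower2 d_gt0.
exists (8 * C4 + 8 * C3 + C1 + C2) => n n0.
have F_gt0 mu : (0 < msize n (code_rate mu d))%N by apply/msize_gt0/Rmax_l.
have tau_ge0 x : 0 <= Rpower 2 x by apply/Rlt_le/Rpower2_gt0.
have [enc [dec1 [dec2 h]]] := one_shot_coding
  (fun (xs : n.-tuple X) (vs : n.-tuple V1) =>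
    typicalb (pushfwd L1 (fun z => (z.1.1.1, z.2))) eps (zip xs vs))
  (fun (xs : n.-tuple X) (vs : n.-tuple V2) =>
    typicalb (pushfwd L2 (fun z => (z.1.1.1, z.2))) eps (zip xs vs))
  [tuple vd0 | i < n] [tuple vd1 | i < n] [tuple vd2 | i < n]
  (receiver_ok_prod n ok1) (receiver_ok_prod n ok2)
  (F_gt0 mu0) (F_gt0 muq1) (F_gt0 muq2)
  (msize_gt0 n R0_ge0) (msize_gt0 n R1_ge0) (msize_gt0 n R2_ge0)
  (likely_cond q0 P1 q1 (joint_metric q0 P1 q1)
    (cond_metric_ge0 ok1) (cond_metric_sum q0 P1 q1) d (n := n))
  (likely_joint q0 P1 q1 (cond_metric q0 P1 q1)
    (joint_metric_ge0 ok1) (joint_metric_sum q0 P1 q1) d (n := n))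
  (likely_cond q0 P2 q2 (joint_metric q0 P2 q2)
    (cond_metric_ge0 ok2) (cond_metric_sum q0 P2 q2) d (n := n))
  (likely_joint q0 P2 q2 (cond_metric q0 P2 q2)
    (joint_metric_ge0 ok2) (joint_metric_sum q0 P2 q2) d (n := n))
  (tau_ge0 (INR n * (mu0 + d))) (tau_ge0 (INR n * (muq1 + d))) (tau_ge0 (INR n * (muq2 + d))).
exists enc, dec1, dec2; apply: Rle_trans h _.
rewrite !Rdiv_plus_distr; apply: Rplus_le_compat; last exact: b2.
apply: Rplus_le_compat; last exact: b1.
apply: Rplus_le_compat.
  rewrite /Rdiv Rmult_assoc; apply: Rmult_le_compat_l; first lra.
  by apply: Rle_trans (msize_tau n mu0 d) (b4 n n0).
rewrite /Rdiv Rmult_assoc; apply: Rmult_le_compat_l; first lra.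
rewrite mean_rlaw_prod; apply: Rle_trans (b3 n n0); apply: Req_le; apply: eq_mean => t /=.
do 3![congr (_ _)]; congr (Rleb _ _).
by apply: eq_bigr => i _; rewrite !tnth_mktuple.
Qed.

End BlockCoding.

(** * Achievability *)

Section Conditioning.
Variables (X Y V0 V : finType) (px : X -> R) (q0 : X -> V0 -> R) (P : X -> Y -> R).
Variable w : X -> V0 -> V -> R.
Hypotheses (px_ok : is_pmf px) (q0_ok : forall x, is_pmf (q0 x)).
Hypotheses (P_ge0 : forall x y, 0 <= P x y) (P_sum : forall x, rsum (P x) = px x).
Hypotheses (w_ge0 : forall x v0 v, 0 <= w x v0 v) (w_sum : forall x v0, rsum (w x v0) = q0 x v0).

Definition conditional (x : X) (v0 : V0) (v : V) : R := w x v0 v * / q0 x v0.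

(** If [q0 x v0 = 0] then the nonnegative row [w x v0] sums to zero, so it vanishes and the division
    by zero is harmless. *)
Lemma conditionalK x v0 v : q0 x v0 * conditional x v0 v = w x v0 v.
Proof.
rewrite /conditional; case: (Req_dec (q0 x v0) 0) => [e|ne]; last by field.
rewrite e Rmult_0_l; apply: Rle_antisym; first exact: w_ge0.
by rewrite -e -w_sum; apply: rsum_ge_term.
Qed.

Lemma receiver_ok_conditional : receiver_ok px q0 P conditional.
Proof.
split=> //.
  move=> x v0 v; apply: Rmult_le_pos => //.
  case: (Rle_lt_or_eq_dec _ _ ((q0_ok x).1 v0)) => [h|<-]; last by rewrite Rinv_0; lra.
  by apply: Rlt_le; apply: Rinv_0_lt_compat.
by move=> x v0 h; rewrite /conditional -rsumMr w_sum Rinv_r; lra.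
Qed.

Lemma rlaw_conditional z : rlaw q0 P conditional z = P (zX z) (zY z) * w (zX z) (zV0 z) (zV z).
Proof. by rewrite /rlaw Rmult_assoc conditionalK. Qed.

Lemma pushfwd_conditional x v :
  pushfwd (rlaw q0 P conditional) (fun z => (z.1.1.1, z.2)) (x, v) = px x * \rsum_v0 w x v0 v.
Proof.
rewrite pushfwdE (@eq_rsum _ _ (fun z => rlaw q0 P conditional z *
  (bR (zX z == x) * bR (zV z == v)))); last by move=> z /=; rewrite xpair_eqE bRM /zX /zV; lra.
rewrite -/(mean _ _) mean_rlaw.
rewrite (@eq_rsum _ _ (fun x' => bR (x' == x) * (rsum (P x') * \rsum_v0 w x' v0 v))).
  by rewrite rsum_eq1 P_sum.
move=> x' /=; rewrite !rsumMl; apply: eq_rsum => v0.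
rewrite -(conditionalK x' v0 v) rsumMl.
rewrite (@eq_rsum _ _ (fun v' => bR (v' == v) *
  (q0 x' v0 * (conditional x' v0 v' * (rsum (P x') * bR (x' == x)))))); last first.
  move=> v' /=; rewrite /zX /zV /= -rsumMr; lra.
by rewrite rsum_eq1; lra.
Qed.

End Conditioning.

Lemma cmi_pushfwd (O A B C D : finType) (Q : O -> R) (L : A -> R) (f : O -> A)
    (a : A -> B) (b : A -> C) (c : A -> D) :
  (forall z, L z = pushfwd Q f z) ->
  cmi L a b c = cmi Q (fun w => a (f w)) (fun w => b (f w)) (fun w => c (f w)).
Proof.
move=> h; rewrite /cmi (ent_pushfwd c h) (ent_pushfwd (fun z => (a z, c z)) h).
by rewrite (ent_pushfwd (fun z => (b z, c z)) h) (ent_pushfwd (fun z => (a z, b z, c z)) h).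
Qed.

Section Achievability.
Variables (X Y1 Y2 V0 V1 V2 : finType) (P : X * Y1 * Y2 -> R) (W : X -> V0 * V1 * V2 -> R).
Hypotheses (P_pmf : is_pmf P) (W_chan : is_channel W).

Definition PXY1 (x : X) (y1 : Y1) : R := \rsum_y2 P (x, y1, y2).
Definition PXY2 (x : X) (y2 : Y2) : R := \rsum_y1 P (x, y1, y2).
Definition WV0 (x : X) (v0 : V0) : R := \rsum_v1 \rsum_v2 W x (v0, v1, v2).
Definition WV01 (x : X) (v0 : V0) (v1 : V1) : R := \rsum_v2 W x (v0, v1, v2).
Definition WV02 (x : X) (v0 : V0) (v2 : V2) : R := \rsum_v1 W x (v0, v1, v2).

Lemma PX_pmf : is_pmf (PX P).
Proof.
split=> [x|]; first by apply: rsum_ge0 => y; apply: P_pmf.1.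
rewrite -P_pmf.2 !rsum_pair; apply: eq_rsum => x; rewrite /PX rsum_pair //.
Qed.

Lemma WV0_pmf x : is_pmf (WV0 x).
Proof.
split=> [v0|]; first by do 2!apply: rsum_ge0 => ?; apply: (W_chan x).1.
by rewrite -(W_chan x).2 !rsum_pair.
Qed.

Lemma receiver_ok1 : receiver_ok (PX P) WV0 PXY1 (conditional WV0 WV01).
Proof.
apply: receiver_ok_conditional => //; [exact: PX_pmf | exact: WV0_pmf | | | ].
- by move=> x y; apply: rsum_ge0 => ?; apply: P_pmf.1.
- by move=> x; rewrite /PX rsum_pair.
- by move=> x v0 v; apply: rsum_ge0 => ?; apply: (W_chan x).1.
Qed.

Lemma receiver_ok2 : receiver_ok (PX P) WV0 PXY2 (conditional WV0 WV02).
Proof.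
apply: receiver_ok_conditional => //; [exact: PX_pmf | exact: WV0_pmf | | | | ].
- by move=> x y; apply: rsum_ge0 => ?; apply: P_pmf.1.
- by move=> x; rewrite /PX rsum_pair rsum_exchange.
- by move=> x v0 v; apply: rsum_ge0 => ?; apply: (W_chan x).1.
- by move=> x v0; rewrite /WV0 rsum_exchange.
Qed.

(** Since [joint] is a product of source and channel, [y2] and [v2] are summed out in separate
    factors. This carries the mutual informations of [joint] over to the receiver. *)
Lemma rlaw1_pushfwd z : rlaw WV0 PXY1 (conditional WV0 WV01) z =
  pushfwd (joint P W) (fun w => (oX w, oY1 w, oV0 w, oV1 w)) z.
Proof.
rewrite rlaw_conditional; last 2 first.
- by move=> x v0 v; apply: rsum_ge0 => ?; apply: (W_chan x).1.
- by [].
case: z => [[[x y] v0] v]; rewrite /zX /zY /zV0 /zV /= pushfwdE.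
rewrite (@eq_rsum _ _ (fun w => (bR (w.1.1.1 == x) * (bR (w.1.1.2 == y) * P w.1)) *
  (bR (w.2.1.1 == v0) * (bR (w.2.1.2 == v) * W w.1.1.1 w.2)))); last first.
  by move=> u /=; rewrite !xpair_eqE !bRM /joint /oX /oY1 /oV0 /oV1; lra.
rewrite rsum_pair /=.
rewrite (@eq_rsum _ _ (fun a => (bR (a.1.1 == x) * (bR (a.1.2 == y) * P a)) * WV01 a.1.1 v0 v)).
  rewrite !rsum_pair /=.
  rewrite (@eq_rsum _ _ (fun x' => bR (x' == x) *
    (\rsum_y' bR (y' == y) * (PXY1 x' y' * WV01 x' v0 v)))); first by rewrite !rsum_eq1.
  move=> x' /=; rewrite rsumMl; apply: eq_rsum => y'.
  rewrite /PXY1 rsumMr !rsumMl; apply: eq_rsum => y2; lra.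
move=> a /=; rewrite -rsumMl; congr (_ * _); rewrite !rsum_pair /=.
rewrite (@eq_rsum _ _ (fun v0' => bR (v0' == v0) *
    (\rsum_v' bR (v' == v) * WV01 a.1.1 v0' v'))); first by rewrite !rsum_eq1.
by move=> v0' /=; rewrite rsumMl; apply: eq_rsum => v'; rewrite /WV01 !rsumMl.
Qed.

Lemma rlaw2_pushfwd z : rlaw WV0 PXY2 (conditional WV0 WV02) z =
  pushfwd (joint P W) (fun w => (oX w, oY2 w, oV0 w, oV2 w)) z.
Proof.
rewrite rlaw_conditional; last 2 first.
- by move=> x v0 v; apply: rsum_ge0 => ?; apply: (W_chan x).1.
- by move=> x v0; rewrite /WV0 rsum_exchange.
case: z => [[[x y] v0] v]; rewrite /zX /zY /zV0 /zV /= pushfwdE.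
rewrite (@eq_rsum _ _ (fun w => (bR (w.1.1.1 == x) * (bR (w.1.2 == y) * P w.1)) *
  (bR (w.2.1.1 == v0) * (bR (w.2.2 == v) * W w.1.1.1 w.2)))); last first.
  by move=> u /=; rewrite !xpair_eqE !bRM /joint /oX /oY2 /oV0 /oV2; lra.
rewrite rsum_pair /=.
rewrite (@eq_rsum _ _ (fun a => (bR (a.1.1 == x) * (bR (a.2 == y) * P a)) * WV02 a.1.1 v0 v)).
  rewrite !rsum_pair /=.
  rewrite (@eq_rsum _ _ (fun x' => bR (x' == x) *
    (\rsum_y' bR (y' == y) * (PXY2 x' y' * WV02 x' v0 v)))); first by rewrite !rsum_eq1.
  move=> x' /=; rewrite rsum_exchange rsumMl; apply: eq_rsum => y'.
  rewrite /PXY2 rsumMr !rsumMl; apply: eq_rsum => y1; lra.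
move=> a /=; rewrite -rsumMl; congr (_ * _); rewrite !rsum_pair /=.
rewrite (@eq_rsum _ _ (fun v0' => bR (v0' == v0) *
    (\rsum_v' bR (v' == v) * WV02 a.1.1 v0' v'))); first by rewrite !rsum_eq1.
move=> v0' /=; rewrite rsum_exchange rsumMl; apply: eq_rsum => v'.
by rewrite /WV02 !rsumMl.
Qed.

Variables (W1 : X -> V1 -> R) (W2 : X -> V2 -> R).
Hypothesis W_marg : marginals_ok W W1 W2.

(** The prescribed marginals enter here: the block code aims at typicality for the receiver's own
    law, which must be the target law. *)
Lemma typical_law1 a :
  pushfwd (rlaw WV0 PXY1 (conditional WV0 WV01)) (fun z => (z.1.1.1, z.2)) a = PXV P W1 a.
Proof.
case: a => x v; rewrite (pushfwd_conditional (px := PX P)) /PXV /=.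
- by rewrite -(W_marg.1 x v) rsum_pair.
- by move=> x'; rewrite /PX rsum_pair.
- by move=> x' v0 v'; apply: rsum_ge0 => ?; apply: (W_chan x').1.
- by [].
Qed.

Lemma typical_law2 a :
  pushfwd (rlaw WV0 PXY2 (conditional WV0 WV02)) (fun z => (z.1.1.1, z.2)) a = PXV P W2 a.
Proof.
case: a => x v; rewrite (pushfwd_conditional (px := PX P)) /PXV /=.
- by rewrite -(W_marg.2 x v) rsum_pair.
- by move=> x'; rewrite /PX rsum_pair rsum_exchange.
- by move=> x' v0 v'; apply: rsum_ge0 => ?; apply: (W_chan x').1.
- by move=> x' v0; rewrite /WV0 rsum_exchange.
Qed.

Lemma err_prob1 n eps (out : n.-tuple X -> n.-tuple Y1 -> n.-tuple V1) :
  err_prob P (PXV P W1) eps (fun xs y1 (_ : n.-tuple Y2) => zip xs (out xs y1)) =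
  atypical_prob eps PXY1 (rlaw WV0 PXY1 (conditional WV0 WV01)) out.
Proof.
rewrite /err_prob /atypical_prob !rsum_pair /=; apply: eq_rsum => xs; apply: eq_rsum => ys.
rewrite -rsumMr; congr (_ * _).
  by rewrite /iid /= (rsum_tuple_prod (fun i y2 => P (tnth xs i, tnth ys i, y2))).
by rewrite (eq_typicalb _ _ typical_law1); case: (typicalb _ _ _).
Qed.

Lemma err_prob2 n eps (out : n.-tuple X -> n.-tuple Y2 -> n.-tuple V2) :
  err_prob P (PXV P W2) eps (fun xs (_ : n.-tuple Y1) y2 => zip xs (out xs y2)) =
  atypical_prob eps PXY2 (rlaw WV0 PXY2 (conditional WV0 WV02)) out.
Proof.
rewrite /err_prob /atypical_prob !rsum_pair /=; apply: eq_rsum => xs.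
rewrite rsum_exchange; apply: eq_rsum => ys.
rewrite -rsumMr; congr (_ * _).
  by rewrite /iid /= (rsum_tuple_prod (fun i y1 => P (tnth xs i, y1, tnth ys i))).
by rewrite (eq_typicalb _ _ typical_law2); case: (typicalb _ _ _).
Qed.

Lemma err_prob_ge0 (A : finType) n (p : A -> R) eps (f : n.-tuple X -> _) :
  0 <= err_prob P p eps f.
Proof.
apply: rsum_ge0 => t; apply: Rmult_le_pos; first by apply: rprod_ge0 => i; apply: P_pmf.1.
by case: (typicalb _ _ _); lra.
Qed.

Lemma achievable_of_rates (r : R * R * R) :
  0 <= r.1.1 -> 0 <= r.1.2 -> 0 <= r.2 ->
  let Q := joint P W in
  r.1.2 > cmi Q oX oV1 (fun w => (oV0 w, oY1 w)) ->
  r.2   > cmi Q oX oV2 (fun w => (oV0 w, oY2 w)) ->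
  r.1.1 + r.1.2 > cmi Q oX (fun w => (oV0 w, oV1 w)) oY1 ->
  r.1.1 + r.2   > cmi Q oX (fun w => (oV0 w, oV2 w)) oY2 ->
  achievable P W1 W2 r.
Proof.
move=> r0 r1 r2 Q h1 h2 h01 h02 eps eps0.
(* Default letters exist because a law of total mass 1 cannot live on an empty alphabet. *)
have [x _] := pmf_inhabited PX_pmf; have [[[vd0 vd1] vd2] _] := pmf_inhabited (W_chan x).
have [C hC] := block_coding receiver_ok1 receiver_ok2 vd0 vd1 vd2 r0 r1 r2 eps0
  (eq_ind_r (fun c => c < _) h1 (cmi_pushfwd zX zV (fun z => (zV0 z, zY z)) rlaw1_pushfwd))
  (eq_ind_r (fun c => c < _) h2 (cmi_pushfwd zX zV (fun z => (zV0 z, zY z)) rlaw2_pushfwd))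
  (eq_ind_r (fun c => c < _) h01 (cmi_pushfwd zX (fun z => (zV0 z, zV z)) zY rlaw1_pushfwd))
  (eq_ind_r (fun c => c < _) h02 (cmi_pushfwd zX (fun z => (zV0 z, zV z)) zY rlaw2_pushfwd)).
pose code n := ((n.-tuple X -> 'I_(msize n r.1.1) * 'I_(msize n r.1.2) * 'I_(msize n r.2)) *
  ('I_(msize n r.1.1) -> 'I_(msize n r.1.2) -> n.-tuple Y1 -> n.-tuple V1) *
  ('I_(msize n r.1.1) -> 'I_(msize n r.2) -> n.-tuple Y2 -> n.-tuple V2))%type.
pose e1 n (c : code n) := err_prob P (PXV P W1) eps
  (fun xs y1 _ => zip xs (c.1.2 (c.1.1 xs).1.1 (c.1.1 xs).1.2 y1)).
pose e2 n (c : code n) := err_prob P (PXV P W2) eps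
  (fun xs _ y2 => zip xs (c.2 (c.1.1 xs).1.1 (c.1.1 xs).2 y2)).
have ex n : exists c : code n, (0 < n)%N -> e1 n c + e2 n c <= C / INR n.
  (* A code is required at block length 0 as well, where nothing is claimed about its error; the
     message sets are nonempty, so an arbitrary one exists. *)
  case: (posnP n) => [n0|n0].
    exists (fun=> (Ordinal (msize_gt0 n r0), Ordinal (msize_gt0 n r1), Ordinal (msize_gt0 n r2)),
      fun _ _ _ => [tuple vd1 | i < n], fun _ _ _ => [tuple vd2 | i < n]).
    by rewrite n0.
  have [enc [dec1 [dec2 h]]] := hC n n0; exists (enc, dec1, dec2) => _.
  by rewrite /e1 /e2 (err_prob1 eps (fun xs => dec1 _ _)) (err_prob2 eps (fun xs => dec2 _ _)).
pose c n := sval (constructive_indefinite_description _ (ex n)).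
have hc n : (0 < n)%N -> e1 n (c n) + e2 n (c n) <= C / INR n.
  exact: (svalP (constructive_indefinite_description _ (ex n))).
have e1_ge0 n : 0 <= e1 n (c n) by exact: err_prob_ge0.
have e2_ge0 n : 0 <= e2 n (c n) by exact: err_prob_ge0.
exists (fun n => (c n).1.1), (fun n => (c n).1.2), (fun n => (c n).2); split.
  apply: (Oinv_Un_cv e1_ge0); exists C => n n0; have := hc n n0; have := e2_ge0 n; lra.
apply: (Oinv_Un_cv e2_ge0); exists C => n n0; have := hc n n0; have := e1_ge0 n; lra.
Qed.

End Achievability.

Theorem theorem2 (X Y1 Y2 V1 V2 : finType) (P : X * Y1 * Y2 -> R)
    (W1 : X -> V1 -> R) (W2 : X -> V2 -> R) :
  is_pmf P -> is_channel W1 -> is_channel W2 ->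
  (forall r, R_inner_star P W1 W2 r -> R_inner P W1 W2 r) /\
  (forall r, R_inner P W1 W2 r -> R_LGW P W1 W2 r) /\
  convex3 (R_inner P W1 W2).
Proof.
move=> P_pmf _ _; split; first exact: R_inner_star_sub.
split; last exact: R_inner_convex.
apply: closure3_sub => r [r0 [r1 [r2 [V0 [W [W_chan [W_marg [h1 [h2 [h01 h02]]]]]]]]]].
exact: (achievable_of_rates P_pmf W_chan W_marg).
Qed.
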